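(* Let $\mathcal{A}=\mathbb{R}[\boldsymbol{Q}_1,\boldsymbol{Q}_2,\boldsymbol{Q}_3,\boldsymbol{P}_1,\boldsymbol{P}_2,\boldsymbol{P}_3]^{G}$ be the algebra of real polynomial functions on $T^*\mathbb{R}^{12}\cong\mathbb{R}^{24}$ that are invariant under the diagonal action $\Psi_S$, $S\in G$. Then the symmetry reduced regularised 3-body problem has a Lie-Poisson structure with algebra $\mathfrak{u}(3,3)$ and a corresponding Hilbert basis of $36$ quadratic functions. That is: $\mathcal{A}$ has a Hilbert basis consisting of $36$ linearly independent $\Psi_S$-invariant quadratic forms, and the real linear span of these $36$ forms is closed under the Poisson bracket and, with the Poisson bracket as Lie bracket, is isomorphic as a real Lie algebra to $\mathfrak{u}(3,3)$.
   Context: Regularised phase space of the 3-body problem: each of the three difference vectors between the bodies and its difference momentum is represented by a pair $(\boldsymbol{Q}_i,\boldsymbol{P}_i)\in\mathbb{R}^4\times\mathbb{R}^4$ (quaternions viewed as column vectors), $i=1,2,3$. The phase space is $T^*\mathbb{R}^{12}$ with coordinates $(\boldsymbol{Q}_1,\boldsymbol{Q}_2,\boldsymbol{Q}_3,\boldsymbol{P}_1,\boldsymbol{P}_2,\boldsymbol{P}_3)$ and the standard Poisson bracket: the components satisfy $\{Q_{i,a},P_{j,b}\}=\delta_{ij}\delta_{ab}$, all other brackets of coordinates being zero. Symmetry group: let $$K=\begin{pmatrix}0&0&0&-1\\0&0&1&0\\0&-1&0&0\\1&0&0&0\end{pmatrix},\qquad \operatorname{Isoc}(\hat{\boldsymbol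 L})=\begin{pmatrix}\hat{\boldsymbol L}&-\boldsymbol L\\ \boldsymbol L^{t}&0\end{pmatrix}\quad(\boldsymbol L\in\mathbb{R}^3),$$ where $\hat{\boldsymbol L}$ is the skew $3\times3$ matrix with $\hat{\boldsymbol L}\boldsymbol v=\boldsymbol L\times\boldsymbol v$. Let $G\subset SO(4)$ be the subgroup of all matrices $\exp\!\big(\tfrac12(\operatorname{Isoc}(\hat{\boldsymbol L})+\tau K)\big)$, $\boldsymbol L\in\mathbb{R}^3$, $\tau\in\mathbb{R}$. For $S\in G$ the diagonal action is $\Psi_S:(\boldsymbol{Q}_i,\boldsymbol{P}_i)_{i=1}^3\mapsto(S\boldsymbol{Q}_i,S\boldsymbol{P}_i)_{i=1}^3$. The symmetry reduction is carried out by using polynomial invariants of $\Psi_S$ as coordinates. A Hilbert basis of an algebra of invariants is a finite minimal set of homogeneous generators of the algebra. $\mathfrak{u}(3,3)$ is the real Lie algebra, under the commutator, of complex $6\times6$ matrices $M$ with $(HM)^\dagger+HM=0$, i.e. the unitary Lie algebra of an indefinite form of signature $(3,3)$, realised with $H=iJ_6$, where $J_6=\begin{pmatrix}0&I_3\\-I_3&0\end{pmatrix}$. *)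

(* Defs.v *)
From HB Require Import structures.
From mathcomp Require Import all_boot all_order all_algebra.
From mathcomp Require Import complex.
(* mpoly has to come before the mathcomp-analysis files: in the other order
   its notations do not load. *)
From mathcomp Require Import mpoly.
From mathcomp Require Import classical_sets functions cardinality reals.
From mathcomp Require Import topology normedtype sequences.

Set Implicit Arguments.
Unset Strict Implicit.
Unset Printing Implicit Defensive.

Import Order.TTheory GRing.Theory Num.Theory numFieldNormedType.Exports.
Local Open Scope ring_scope.
Local Open Scope classical_set_scope.

(* The coordinates of T^*R^12 are ordered as
   (Q_{1,1}, Q_{1,2}, ..., Q_{3,4}, P_{1,1}, ..., P_{3,4}). *)
Notation phase_dim := (3 * 4 + 3 * 4)%N.

Definition qvar (i : 'I_3) (a : 'I_4) : 'I_phase_dim :=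
  lshift (3 * 4) (mxvec_index i a).

Definition pvar (i : 'I_3) (a : 'I_4) : 'I_phase_dim :=
  rshift (3 * 4) (mxvec_index i a).

Definition phase_coord (R : Type) (Q P : 'I_3 -> 'cV[R]_4) :
    'I_phase_dim -> R :=
  row_mx (mxvec (\matrix_(i, a) Q i a 0)) (mxvec (\matrix_(i, a) P i a 0)) 0.

Lemma phase_coord_qvar (R : Type) (Q P : 'I_3 -> 'cV[R]_4) i a :
  phase_coord Q P (qvar i a) = Q i a 0.
Proof. by rewrite /phase_coord /qvar row_mxEl mxvecE mxE. Qed.

Lemma phase_coord_pvar (R : Type) (Q P : 'I_3 -> 'cV[R]_4) i a :
  phase_coord Q P (pvar i a) = P i a 0.
Proof. by rewrite /phase_coord /pvar row_mxEr mxvecE mxE. Qed.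

Definition poisson (R : realType) (f g : {mpoly R[phase_dim]}) :
    {mpoly R[phase_dim]} :=
  \sum_(i < 3) \sum_(a < 4)
    (f^`M(qvar i a) * g^`M(pvar i a) - f^`M(pvar i a) * g^`M(qvar i a)).

Lemma mderiv_var (R : realType) (n : nat) (k l : 'I_n) :
  ('X_k)^`M(l) = (k == l)%:R :> {mpoly R[n]}.
Proof.
rewrite mderivX mnm1E; case: eqP => [->|_]; last by rewrite scale0r.
by rewrite -{1}[U_(l)%MM]add0m addmK mpolyX0 scale1r.
Qed.

Lemma qvar_eq i a j b : (qvar i a == qvar j b) = (i == j) && (a == b).
Proof.
by rewrite eq_lshift (inj_eq (@cast_ord_inj _ _ _)) (inj_eq enum_rank_inj).
Qed.

Lemma pvar_eq i a j b : (pvar i a == pvar j b) = (i == j) && (a == b).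
Proof.
by rewrite eq_rshift (inj_eq (@cast_ord_inj _ _ _)) (inj_eq enum_rank_inj).
Qed.

Lemma qvar_pvar i a j b : (qvar i a == pvar j b) = false.
Proof. exact: eq_lrshift. Qed.

Lemma pvar_qvar i a j b : (pvar i a == qvar j b) = false.
Proof. exact: eq_rlshift. Qed.

Lemma poisson_qp (R : realType) (i j : 'I_3) (a b : 'I_4) :
  poisson 'X_(qvar i a) 'X_(pvar j b)
  = ((i == j) && (a == b))%:R :> {mpoly R[phase_dim]}.
Proof.
rewrite /poisson (bigD1 i) //= (bigD1 a) //= !mderiv_var qvar_pvar mul0r subr0.
rewrite qvar_eq pvar_eq !eqxx mul1r [j == i]eq_sym [b == a]eq_sym.
rewrite [X in _ + X + _]big1 => [|c /negPf nca]; last first.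
  by rewrite !mderiv_var qvar_pvar qvar_eq [a == c]eq_sym nca andbF !mul0r subr0.
rewrite [X in _ + X]big1 ?addr0 // => k /negPf nki; apply: big1 => c _.
by rewrite !mderiv_var qvar_pvar qvar_eq [i == k]eq_sym nki !mul0r subr0.
Qed.

Lemma poisson_qq (R : realType) (i j : 'I_3) (a b : 'I_4) :
  poisson 'X_(qvar i a) 'X_(qvar j b) = 0 :> {mpoly R[phase_dim]}.
Proof.
apply: big1 => k _; apply: big1 => c _.
by rewrite !mderiv_var !qvar_pvar mulr0 mul0r subr0.
Qed.

Lemma poisson_pp (R : realType) (i j : 'I_3) (a b : 'I_4) :
  poisson 'X_(pvar i a) 'X_(pvar j b) = 0 :> {mpoly R[phase_dim]}.
Proof.
apply: big1 => k _; apply: big1 => c _.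
by rewrite !mderiv_var !pvar_qvar mulr0 mul0r subr0.
Qed.

(* The series converges for every A, so the value of lim is meaningful. *)
Definition expmx (R : realType) (n : nat) (A : 'M[R]_n.+1) : 'M[R]_n.+1 :=
  limn (series (fun k => (k`!%:R)^-1 *: A ^+ k)).

Definition mx_of_rows (R : realType) (m n : nat) (s : seq (seq R)) :
    'M[R]_(m, n) :=
  \matrix_(i, j) (nth [::] s i)`_j.

Definition K_mx (R : realType) : 'M[R]_4 :=
  mx_of_rows 4 4 [:: [:: 0;  0; 0; -1];
                     [:: 0;  0; 1;  0];
                     [:: 0; -1; 0;  0];
                     [:: 1;  0; 0;  0]].

(* The row indices 0, 1, 2 below are elements of 'I_3. *)
Definition crossv (R : realType) (u v : 'cV[R]_3) : 'cV[R]_3 :=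
  \col_i [:: u 1 0 * v 2 0 - u 2 0 * v 1 0;
             u 2 0 * v 0 0 - u 0 0 * v 2 0;
             u 0 0 * v 1 0 - u 1 0 * v 0 0]`_i.

Definition hat_mx (R : realType) (L : 'cV[R]_3) : 'M[R]_3 :=
  mx_of_rows 3 3 [:: [::   0    ; - L 2 0;   L 1 0];
                     [::   L 2 0;   0    ; - L 0 0];
                     [:: - L 1 0;   L 0 0;   0    ]].

Lemma hat_mxE (R : realType) (L v : 'cV[R]_3) : hat_mx L *m v = crossv L v.
Proof.
apply/colP => i; rewrite !mxE; do 3! rewrite big_ord_recl; rewrite big_ord0 !mxE /=.
have -> : lift ord0 ord0 = 1 :> 'I_3 by apply/val_inj.
have -> : lift ord0 (lift ord0 ord0) = 2 :> 'I_3 by apply/val_inj.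
case: i => -[|[|[|//]]] lt_i3 /=; rewrite ?mul0r ?addr0 ?add0r ?mulNr //;
  by rewrite addrC.
Qed.

Definition isoc (R : realType) (L : 'cV[R]_3) : 'M[R]_(3 + 1) :=
  block_mx (hat_mx L) (- L) L^T 0.

Definition G (R : realType) : set 'M[R]_4 :=
  [set S | exists (L : 'cV[R]_3) (tau : R),
     S = expmx (2^-1 *: (isoc L + tau *: K_mx R))].

(* Real polynomial functions on R^24 are represented by polynomials, which is
   harmless since R is infinite. *)
Definition invariants (R : realType) : set {mpoly R[phase_dim]} :=
  [set f | forall S, G S -> forall Q P : 'I_3 -> 'cV[R]_4,
     f.@[phase_coord (fun i => S *m Q i) (fun i => S *m P i)]
     = f.@[phase_coord Q P]].

Definition generated_algebra (R : realType) (n : nat)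
    (B : set {mpoly R[n]}) : set {mpoly R[n]} :=
  smallest (fun A => GRing.subalg_closed (mem A)) B.

Definition hilbert_basis (R : realType) (n : nat)
    (A B : set {mpoly R[n]}) : Prop :=
  [/\ finite_set B,
      (forall f, B f -> exists d : nat, f \is d.-homog),
      generated_algebra B = A
    & forall B', B' `<=` B -> generated_algebra B' = A -> B' = B].

Definition lin_indep (R : realType) (V : lmodType R) (n : nat)
    (B : 'I_n -> V) : Prop :=
  forall c : 'I_n -> R, \sum_(j < n) c j *: B j = 0 -> forall j, c j = 0.

Definition lin_span (R : realType) (V : lmodType R) (n : nat)
    (B : 'I_n -> V) : set V :=
  [set f | exists c : 'I_n -> R, f = \sum_(j < n) c j *: B j].

Local Open Scope complex_scope.

Definition J6 (R : realType) : 'M[R[i]]_(3 + 3) :=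
  block_mx 0 1%:M (- 1%:M) 0.

Definition u33 (R : realType) : set 'M[R[i]]_(3 + 3) :=
  let H := 'i%C *: J6 R in
  [set M | map_mx conjc (H *m M)^T + H *m M = 0].

(* V with the bracket br is isomorphic on its subspace g, as a real Lie algebra,
   to the space h of complex matrices with the commutator. *)
Definition lie_isomorphic (R : realType) (V : lmodType R)
    (br : V -> V -> V) (g : set V) (n : nat) (h : set 'M[R[i]]_n) : Prop :=
  exists phi : V -> 'M[R[i]]_n,
    [/\ set_bij g h phi,
        (forall (a : R) x y, g x -> g y ->
           phi (a *: x + y) = a%:C *: phi x + phi y)
      & forall x y, g x -> g y ->
           phi (br x y) = phi x *m phi y - phi y *m phi x].

(* Main.v *)
(** The matrix [K] is a complex structure on R^4 for which [G] acts as U(2) on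
    C^2, so the quadratic invariants of six vectors x_i are the real and
    imaginary parts x_i . x_j and x_i . K x_j of their Hermitian products.

    They generate all invariants. For the Fischer product <f, g> = f(d) g (0),
    multiplication by a variable is adjoint to differentiation. Put
    T = sum_q q q(d) over the quadratic invariants q,
    e_ab = sum_i x_ia d/dx_ib and h = e + K e K^T. Then T = sum_ab e_ab h_ab,
    an invariant f satisfies h_ab f = h_ba f, and
    <f, T f> = 1/2 sum_ab |h_ab f|^2. So T f = 0 forces
    0 = sum_a h_aa f = 2 deg(f) f: on the invariants of a positive degree T is
    injective, hence surjective, and f = T g = sum_q q (q(d) g) with q(d) g an
    invariant of smaller degree.

    The span of the 36 forms consists of the quadratic Hamiltonians q_F of
    Hermitian 6 x 6 matrices F. Their Poisson bracket is
    {q_F, q_F'} = q_(F J F' - F' J F), so F |-> J F is the isomorphism onto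
    u(3,3). *)

From HB Require Import structures.
Require Import Defs.
From mathcomp Require Import all_boot all_order all_algebra.
From mathcomp Require Import ring lra complex.
From mathcomp Require Import mpoly ssrcomplements.
From mathcomp Require Import classical_sets boolp functions cardinality reals.
From mathcomp Require Import topology normedtype sequences derive trigo.

Set Implicit Arguments.
Unset Strict Implicit.
Unset Printing Implicit Defensive.

Import Order.TTheory GRing.Theory Num.Theory numFieldNormedType.Exports.
Local Open Scope ring_scope.
Local Open Scope classical_set_scope.

(** * The Fischer product *)

(** Invariance enters only infinitesimally: an invariant is killed by the flow of every
    antisymmetric [Y] commuting with [K]. Positivity of the Fischer product takes the place of an
    average over the compact group, so the algebraic part works over any [realFieldType]. The two
    kinds of forms have to enter T together. Normal ordering of each sum of q q(d) leaves a
    first-order term, with coefficient matrix 1 for the dot products and K K = -1 for the others,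
    and the two cancel. The factor 1/2 in <f, T f> arises because conjugation by K exchanges the two
    summands of h. Passing from G to its Lie algebra needs elements of G in closed form: [K] and a
    normalised [isoc] are commuting complex structures, so their exponentials are products of
    rotations. Minimality is read off at the origin, where all 36 forms have zero value and zero
    gradient, so that no product of two of them is seen by a second derivative. The number 36 splits
    into 21 forms x_i . x_j with i <= j and 15 forms x_i . K x_j with i > j. *)

Section Fischer.
Variables (R : realFieldType) (n : nat).
Implicit Types (f g h : {mpoly R[n]}) (m : 'X_{1..n}) (k : 'I_n).

Definition mnm_fact m : nat := \prod_(i < n) (m i)`!.

(** This is f(d) g at 0 in coefficients: monomials are orthogonal, and ['X_[m]] has squared norm m!,
    the value of its own derivative of order m. *)
Definition fischer f g : R :=
  \sum_(m <- msupp f) f@_m * g@_m * (mnm_fact m)%:R.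

(** A range of summation independent of the support of [f], so that the two factors can be
    exchanged. *)
Lemma fischerwE d f g : (msize f <= d)%N ->
  fischer f g = \sum_(m : 'X_{1..n < d}) f@_m * g@_m * (mnm_fact m)%:R.
Proof.
move=> fd; pose I := 'X_{1..n < d}.
rewrite /fischer (big_mksub I) //=; first last.
- by move=> m /msize_mdeg_lt /leq_trans; apply.
- by rewrite msupp_uniq.
rewrite big_rmcond //= => m /memN_msupp_eq0 ->; by rewrite !mul0r.
Qed.

Lemma fischerC f g : fischer f g = fischer g f.
Proof.
pose d := maxn (msize f) (msize g).
rewrite (@fischerwE d) ?leq_maxl // (@fischerwE d) ?leq_maxr //.
by apply: eq_bigr => m _; rewrite (mulrC f@_m).
Qed.

Lemma fischer_linearr f : scalar (fischer f).
Proof.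
move=> c g h; rewrite /fischer mulr_sumr -big_split /=; apply: eq_bigr => m _.
by rewrite mcoeffD mcoeffZ mulrDr mulrDl mulrCA !mulrA.
Qed.

HB.instance Definition _ f :=
  GRing.isLinear.Build R {mpoly R[n]} R *%R (fischer f) (fischer_linearr f).

Lemma fischerZr c f g : fischer f (c *: g) = c * fischer f g.
Proof. by rewrite -[c *: g]addr0 fischer_linearr raddf0 addr0. Qed.

Lemma fischerX m g : fischer 'X_[m] g = g@_m * (mnm_fact m)%:R.
Proof. by rewrite /fischer msuppX big_seq1 mcoeffX eqxx mul1r. Qed.

Lemma mnm_factDU m k : mnm_fact (m + U_(k)) = ((m k).+1 * mnm_fact m)%N.
Proof.
rewrite /mnm_fact (bigD1 k) //= [in RHS](bigD1 k) //= mulnA; congr (_ * _)%N.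
  by rewrite mnmDE mnm1E eqxx addn1 factS.
by apply: eq_bigr => i /negPf ik; rewrite mnmDE mnm1E eq_sym ik addn0.
Qed.

(** By linearity [f] is a monomial ['X_[m]]; both sides are then the coefficient of [g] at m + U_k
    times (m + U_k)!, since differentiation produces exactly the factor m_k + 1. *)
Lemma fischer_varl k f g : fischer ('X_k * f) g = fischer f g^`M(k).
Proof.
rewrite fischerC [in RHS]fischerC [f]mpolyE mulr_sumr !linear_sum /=.
apply: eq_bigr => m _; rewrite -scalerAr !fischerZr /=; congr (_ * _).
rewrite -mpolyXD !(fischerC _ 'X_[_]) !fischerX [(U_(k) + m)%MM]addmC.
by rewrite mcoeff_mderiv mnm_factDU natrM mulrA (mulr_natr g@__).
Qed.

Lemma fischer_ge0 f : 0 <= fischer f f.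
Proof. by apply: sumr_ge0 => m _; rewrite mulr_ge0 // -expr2 sqr_ge0. Qed.

Lemma fischer_eq0 f : fischer f f = 0 -> f = 0.
Proof.
move/eqP; rewrite psumr_eq0 => [/allP f0|m _]; last first.
  by rewrite mulr_ge0 // -expr2 sqr_ge0.
apply/mpolyP => m; rewrite mcoeff0; have [mf|/memN_msupp_eq0 //] := boolP (m \in msupp f).
move: (f0 _ mf); rewrite mulf_eq0 pnatr_eq0 -expr2 sqrf_eq0 -leqn0 leqNgt.
by rewrite prodn_gt0 ?orbF => [/eqP //|i]; rewrite fact_gt0.
Qed.

End Fischer.

Lemma mderivXU (R : comNzRingType) (n : nat) (k l : 'I_n) :
  ('X_k)^`M(l) = (k == l)%:R :> {mpoly R[n]}.
Proof.
rewrite mderivX mnm1E; case: eqP => [->|_]; last by rewrite scale0r.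
by rewrite -{1}[U_(l)%MM]add0m addmK mpolyX0 scale1r.
Qed.

Lemma euler_homog (R : comNzRingType) (n d : nat) (f : {mpoly R[n]}) :
  f \is d.-homog -> \sum_(k < n) 'X_k * f^`M(k) = d%:R *: f.
Proof.
move=> /dhomogP fd; rewrite {2}[f]mpolyE scaler_sumr.
under eq_bigr => k _ do rewrite {1}[f]mpolyE raddf_sum mulr_sumr /=.
rewrite exchange_big /=; apply: eq_big_seq => m mf.
have /= <- := fd m mf; rewrite mdegE natr_sum scaler_suml; apply: eq_bigr => k _.
rewrite mderivZ mderivX -!scalerAr scalerA mulrC -scalerA -mpolyXD.
(* For m_k = 0 the subtraction m - U_k truncates, but the factor m_k removes the term. *)
have [->|mk] := posnP (m k); first by rewrite !scale0r.
rewrite addmC submK //; apply/mnm_lepP => i; rewrite mnm1E.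
by case: eqP => // <-.
Qed.

Lemma dhomog_mderiv (R : comNzRingType) (n d : nat) (f : {mpoly R[n]}) (k : 'I_n) :
  f \is d.-homog -> f^`M(k) \is d.-1.-homog.
Proof.
move=> /dhomogP fd; rewrite [f]mpolyE raddf_sum /= big_seq rpred_sum //= => m mf.
rewrite mderivZ mderivX; apply: rpredZ.
(* This case also covers d = 0, where [d.-1] truncates: the derivative is 0, which is homogeneous of
   every degree. *)
have [->|mk] := posnP (m k); first by rewrite scale0r rpred0.
have km : (U_(k) <= m)%MM.
  by apply/mnm_lepP => i; rewrite mnm1E; case: eqP => // <-.
apply: rpredZ; rewrite dhomogX /=; have /= <- := fd m mf.
by rewrite -{2}(submK km) mdegD mdeg1 addn1.
Qed.

(** * The first fundamental theorem for the unitary group, in real form *)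

Section Polarization.
Variables (R : realFieldType) (n m : nat) (I : finType).
Variable (x : I -> 'I_m -> 'I_n).
Hypothesis x_bij : bijective (fun p => x p.1 p.2).
Implicit Types (f g : {mpoly R[n]}) (C Y : 'M[R]_m) (i j : I) (a b : 'I_m).

(** The operator e_ab. The bijection [x] arranges the variables as a family of vectors x_i of R^m,
    and a matrix acts on all of them at once. *)
Definition polarization a b f : {mpoly R[n]} :=
  \sum_i 'X_(x i a) * f^`M(x i b).

(* The derivative of [f] along the linear vector field x' = Y x. *)
Definition linear_flow Y f : {mpoly R[n]} :=
  \sum_a \sum_b Y a b *: polarization b a f.

(** The bilinear form x_i^T C x_j. *)
Definition pairing C i j : {mpoly R[n]} :=
  \sum_a \sum_b C a b *: ('X_(x i a) * 'X_(x j b)).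

(** The operator q(d) for q = [pairing C i j]: each variable is replaced by the derivative along
    it. *)
Definition pairing_diff C i j f : {mpoly R[n]} :=
  \sum_a \sum_b C a b *: f^`M(x j b)^`M(x i a).

Lemma x_eq i a j b : (x i a == x j b) = (i == j) && (a == b).
Proof. exact: (inj_eq (bij_inj x_bij) (i, a) (j, b)). Qed.

Lemma polarization_is_linear a b : linear (polarization a b).
Proof.
move=> c f g; rewrite /polarization scaler_sumr -big_split /=; apply: eq_bigr => i _.
by rewrite linearP /= mulrDr scalerAr.
Qed.

HB.instance Definition _ a b :=
  GRing.isLinear.Build R {mpoly R[n]} {mpoly R[n]} _ (polarization a b)
    (polarization_is_linear a b).

Lemma linear_flow_is_linear Y : linear (linear_flow Y).
Proof.
move=> c f g; rewrite /linear_flow scaler_sumr -big_split; apply: eq_bigr => a _ /=.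
rewrite scaler_sumr -big_split; apply: eq_bigr => b _ /=.
by rewrite polarization_is_linear scalerDr !scalerA mulrC.
Qed.

HB.instance Definition _ Y :=
  GRing.isLinear.Build R {mpoly R[n]} {mpoly R[n]} _ (linear_flow Y)
    (linear_flow_is_linear Y).

Lemma linear_flowZ Y c f : linear_flow Y (c *: f) = c *: linear_flow Y f.
Proof. exact: linearZ. Qed.

Lemma pairing_diff_is_linear C i j : linear (pairing_diff C i j).
Proof.
move=> c f g; rewrite /pairing_diff scaler_sumr -big_split; apply: eq_bigr => a _ /=.
rewrite scaler_sumr -big_split; apply: eq_bigr => b _ /=.
by rewrite !mderivD !mderivZ scalerDr !scalerA mulrC.
Qed.

HB.instance Definition _ C i j :=
  GRing.isLinear.Build R {mpoly R[n]} {mpoly R[n]} _ (pairing_diff C i j)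
    (pairing_diff_is_linear C i j).

Lemma polarizationM a b f g :
  polarization a b (f * g) = polarization a b f * g + f * polarization a b g.
Proof.
rewrite /polarization mulr_suml mulr_sumr -big_split; apply: eq_bigr => i _ /=.
rewrite mderivM mulrDr; congr (_ + _); first exact: mulrA.
exact: mulrCA.
Qed.

Lemma linear_flowM Y f g :
  linear_flow Y (f * g) = linear_flow Y f * g + f * linear_flow Y g.
Proof.
rewrite /linear_flow mulr_suml mulr_sumr -big_split; apply: eq_bigr => a _ /=.
rewrite mulr_suml mulr_sumr -big_split; apply: eq_bigr => b _ /=.
by rewrite polarizationM scalerDr -scalerAl -scalerAr.
Qed.

Lemma polarization_var a b i c :
  polarization a b 'X_(x i c) = (b == c)%:R *: 'X_(x i a).
Proof.
rewrite /polarization (bigD1 i) //= big1 ?addr0 => [|j /negPf ji].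
  by rewrite mderivXU x_eq eqxx eq_sym mulr_natr scaler_nat.
by rewrite mderivXU x_eq eq_sym ji mulr0.
Qed.

Lemma linear_flow_var Y i a :
  linear_flow Y 'X_(x i a) = \sum_b Y a b *: 'X_(x i b).
Proof.
rewrite /linear_flow (bigD1 a) //= [X in _ + X]big1 ?addr0 => [|c /negPf ca].
  by apply: eq_bigr => b _; rewrite polarization_var eqxx scale1r.
by apply: big1 => b _; rewrite polarization_var ca scale0r scaler0.
Qed.

Lemma linear_flow_pairing Y C i j :
  Y^T *m C + C *m Y = 0 -> linear_flow Y (pairing C i j) = 0.
Proof.
move=> YC; rewrite /pairing raddf_sum /=.
have E (F : 'I_m -> 'I_m -> {mpoly R[n]}) :
    \sum_a \sum_b \sum_c (C c b * Y c a) *: F a b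
    = \sum_a \sum_b (Y^T *m C) a b *: F a b.
  apply: eq_bigr => a _; apply: eq_bigr => b _; rewrite mxE scaler_suml.
  by apply: eq_bigr => c _; rewrite mxE mulrC.
under eq_bigr => a _ do rewrite raddf_sum /=.
under eq_bigr => a _ do under eq_bigr => b _ do
  rewrite linear_flowZ linear_flowM /= !linear_flow_var mulr_suml mulr_sumr scalerDr.
under eq_bigr => a _ do rewrite big_split /=.
rewrite big_split /=.
have -> : \sum_a \sum_b C a b *: (\sum_c Y a c *: 'X_(x i c) * 'X_(x j b))
   = \sum_a \sum_b (Y^T *m C) a b *: ('X_(x i a) * 'X_(x j b)) :> {mpoly R[n]}.
  rewrite -E [RHS]exchange_big /= exchange_big /=; apply: eq_bigr => b _.
  rewrite exchange_big /=; apply: eq_bigr => a _.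
  rewrite scaler_sumr; apply: eq_bigr => c _.
  by rewrite -scalerAl scalerA.
have -> : \sum_a \sum_b C a b *: (\sum_c 'X_(x i a) * (Y b c *: 'X_(x j c)))
   = \sum_a \sum_b (C *m Y) a b *: ('X_(x i a) * 'X_(x j b)) :> {mpoly R[n]}.
  apply: eq_bigr => a _; under eq_bigr => b _ do rewrite scaler_sumr.
  rewrite exchange_big /=; apply: eq_bigr => b _.
  rewrite mxE scaler_suml; apply: eq_bigr => c _.
  by rewrite -scalerAr scalerA.
rewrite -big_split big1 // => a _; rewrite -big_split big1 // => b _ /=.
by rewrite -scalerDl; move/matrixP/(_ a b): YC; rewrite mxE => ->; rewrite mxE scale0r.
Qed.

Lemma mderiv_polarization a b j c f :
  (polarization a b f)^`M(x j c)
  = polarization a b f^`M(x j c) + (a == c)%:R *: f^`M(x j b).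
Proof.
rewrite /polarization raddf_sum /=.
under eq_bigr => i _ do rewrite mderivM mderivXU x_eq mderiv_comm.
rewrite big_split /= addrC; congr (_ + _).
rewrite (bigD1 j) //= big1 ?addr0 => [|i /negPf ij]; last by rewrite ij mul0r.
by rewrite eqxx mulr_natl scaler_nat.
Qed.

(** Derivatives transform by the dual representation; the correction is the derivative of the
    coefficients of the vector field. *)
Lemma linear_flow_mderiv Y j c f :
  linear_flow Y f^`M(x j c)
  = (linear_flow Y f)^`M(x j c) - \sum_a Y a c *: f^`M(x j a).
Proof.
apply/eqP; rewrite eq_sym subr_eq; apply/eqP.
rewrite /linear_flow raddf_sum -big_split; apply: eq_bigr => a _ /=.
rewrite raddf_sum /=.
under eq_bigr => b _ do rewrite mderivZ mderiv_polarization scalerDr.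
rewrite big_split /=; congr (_ + _).
rewrite (bigD1 c) //= big1 ?addr0 => [|b /negPf bc]; last by rewrite bc scale0r scaler0.
by rewrite eqxx scale1r.
Qed.

(** The dual counterpart of [linear_flow_pairing], whence [Y] and [Y^T] are exchanged in the
    hypothesis. For antisymmetric [Y] both hypotheses say that [Y] commutes with [C]. It makes q(d)
    map invariants to invariants. *)
Lemma linear_flow_pairing_diff Y C i j f :
  C *m Y^T + Y *m C = 0 -> linear_flow Y f = 0 ->
  linear_flow Y (pairing_diff C i j f) = 0.
Proof.
move=> YC Yf; rewrite /pairing_diff raddf_sum /=.
have E a b : linear_flow Y (C a b *: f^`M(x j b)^`M(x i a))
    = - (C a b *: (\sum_c Y c b *: f^`M(x j c)^`M(x i a))
       + C a b *: (\sum_c Y c a *: f^`M(x j b)^`M(x i c))).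
  rewrite linear_flowZ !linear_flow_mderiv Yf mderiv0 sub0r mderivN.
  rewrite -opprD scalerN scalerDr; congr (- (_ *: _ + _)).
  by rewrite raddf_sum; apply: eq_bigr => c _; rewrite /= mderivZ.
under eq_bigr => a _ do rewrite raddf_sum /=.
under eq_bigr => a _ do under eq_bigr => b _ do rewrite E.
under eq_bigr => a _ do rewrite sumrN big_split /=.
rewrite sumrN big_split /=; apply/eqP; rewrite oppr_eq0; apply/eqP.
have -> : \sum_a \sum_b C a b *: (\sum_c Y c b *: f^`M(x j c)^`M(x i a))
   = \sum_a \sum_b (C *m Y^T) a b *: f^`M(x j b)^`M(x i a).
  apply: eq_bigr => a _; under eq_bigr => b _ do rewrite scaler_sumr.
  rewrite exchange_big /=; apply: eq_bigr => b _.
  rewrite mxE scaler_suml; apply: eq_bigr => c _.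
  by rewrite scalerA mxE.
have -> : \sum_a \sum_b C a b *: (\sum_c Y c a *: f^`M(x j b)^`M(x i c))
   = \sum_a \sum_b (Y *m C) a b *: f^`M(x j b)^`M(x i a).
  rewrite exchange_big [RHS]exchange_big /=; apply: eq_bigr => b _.
  under eq_bigr => a _ do rewrite scaler_sumr.
  rewrite exchange_big /=; apply: eq_bigr => a _.
  rewrite mxE scaler_suml; apply: eq_bigr => c _.
  by rewrite scalerA mulrC.
rewrite -big_split big1 // => a _; rewrite -big_split big1 // => b _ /=.
by rewrite -scalerDl; move/matrixP/(_ a b): YC; rewrite mxE => ->; rewrite mxE scale0r.
Qed.

End Polarization.

(** Homogeneous polynomials of degree [d] form a finite-dimensional space, and [T] restricts to an
    injective endomorphism of the common kernel of the [D j] in it; by equality of dimensions the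
    restriction is onto. *)
Lemma dhomog_inj_surj (F : fieldType) (n d : nat) (J : finType)
    (D : J -> {linear {mpoly F[n.+1]} -> {mpoly F[n.+1]}})
    (T : {linear {mpoly F[n.+1]} -> {mpoly F[n.+1]}}) :
  (forall j f, f \is d.-homog -> D j f \is d.-homog) ->
  (forall f, f \is d.-homog -> T f \is d.-homog) ->
  (forall f, (forall j, D j f = 0) -> forall j, D j (T f) = 0) ->
  (forall f, f \is d.-homog -> (forall j, D j f = 0) -> T f = 0 -> f = 0) ->
  forall f, f \is d.-homog -> (forall j, D j f = 0) ->
  exists g, [/\ g \is d.-homog, forall j, D j g = 0 & f = T g].
Proof.
move=> Dd Td DT Tinj f fd Df.
pose restr (L : {linear {mpoly F[n.+1]} -> {mpoly F[n.+1]}})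
    (Ld : forall f, f \is d.-homog -> L f \is d.-homog) (p : dhomog n.+1 F d) :=
  DHomog (Ld _ (dhomog_is_dhomog p)).
have restr_lin L Ld : linear (@restr L Ld).
  by move=> c p q; apply: val_inj; rewrite /= !linearP.
pose lrestr L Ld : {linear dhomog n.+1 F d -> dhomog n.+1 F d} :=
  HB.pack (@restr L Ld) (GRing.isLinear.Build _ _ _ _ _ (restr_lin L Ld)).
pose W := (\bigcap_j lker (linfun (lrestr (D j) (Dd j))))%VS.
pose S := linfun (lrestr T Td).
have WP p : reflect (forall j, D j (val p) = 0) (p \in W).
  apply: (iffP idP) => [pW j|Dp].
    have /subv_bigcapP/(_ j isT) := pW; rewrite -memvE memv_ker lfunE /=.
    by move/eqP/(congr1 val).
  apply/subv_bigcapP => j _; rewrite -memvE memv_ker lfunE /=.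
  by apply/eqP/val_inj; rewrite /= Dp.
have SW : (S @: W)%VS = W.
  apply/eqP; rewrite eqEdim; apply/andP; split.
    apply/subvP => _ /memv_imgP [p /WP Dp ->]; apply/WP => j.
    by rewrite lfunE /=; apply: DT.
  rewrite limg_dim_eq //; apply/eqP; rewrite -subv0; apply/subvP => p.
  rewrite memv_cap memv_ker lfunE => /andP[/WP Dp /eqP/(congr1 val) /= Tp].
  rewrite memv0; apply/eqP/val_inj => /=; apply: Tinj => //.
  exact: dhomog_is_dhomog.
have : DHomog fd \in (S @: W)%VS by rewrite SW; apply/WP.
case/memv_imgP => g /WP Dg /(congr1 val); rewrite lfunE /= => fE.
by exists (val g); split=> //; exact: dhomog_is_dhomog.
Qed.

Lemma dhomog0E (R : nzRingType) (n : nat) (f : {mpoly R[n]}) :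
  f \is 0.-homog -> f = f@_0 *: 1.
Proof.
move=> f0; apply/mpolyP => m; rewrite mcoeffZ mcoeff1.
have [->|m0] := eqVneq m 0%MM; first by rewrite mulr1.
by rewrite mulr0 (dhomog_nemf_coeff f0) //= mdeg_eq0.
Qed.

(** * The operator T and its kernel on invariants *)

Section Casimir.
Variables (R : realFieldType) (n m : nat) (I : finType).
Variable (x : I -> 'I_m -> 'I_n).
Hypothesis x_bij : bijective (fun p => x p.1 p.2).
Implicit Types (f g : {mpoly R[n]}) (C Y : 'M[R]_m) (i j : I) (a b : 'I_m).

Local Notation polarization := (@polarization R n m I x).
Local Notation linear_flow := (@linear_flow R n m I x).
Local Notation pairing := (@pairing R n m I x).
Local Notation pairing_diff := (@pairing_diff R n m I x).

(** Entry (a, b) of C e C^T, where e is the matrix of the operators e_ab. *)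
Definition conj_polarization C a b f : {mpoly R[n]} :=
  \sum_c \sum_d (C a c * C b d) *: polarization c d f.

Lemma polarization_comp a b c d f :
  polarization a b (polarization c d f)
  = \sum_i \sum_j 'X_(x i a) * 'X_(x j c) * f^`M(x j d)^`M(x i b)
    + (b == c)%:R *: polarization a d f.
Proof.
rewrite {1 3}/polarization scaler_sumr -big_split; apply: eq_bigr => i _ /=.
rewrite (mderiv_polarization x_bij) mulrDr; congr (_ + _).
  rewrite /polarization mulr_sumr; apply: eq_bigr => j _.
  by rewrite mulrA mderiv_comm.
by rewrite -scalerAr eq_sym.
Qed.

(** A Capelli-type identity: the left side is the normally ordered form, with all variables to the
    left of all derivatives, of the sum of e_ab (C e C^T)_ab. Reordering costs one first-order term,
    in which the left derivative hits the coefficient of the right operator. *)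
Lemma sum_pairing_diff C f :
  \sum_i \sum_j pairing C i j * pairing_diff C i j f
  = \sum_a \sum_b polarization a b (conj_polarization C a b f)
    - \sum_a \sum_b (C *m C) a b *: polarization a b f.
Proof.
have E a b : polarization a b (conj_polarization C a b f)
    = \sum_c \sum_d (C a c * C b d) *:
        (\sum_i \sum_j 'X_(x i a) * 'X_(x j c) * f^`M(x j d)^`M(x i b))
      + \sum_d (C a b * C b d) *: polarization a d f.
  rewrite /conj_polarization raddf_sum /=.
  under eq_bigr => c _ do rewrite raddf_sum /=.
  under eq_bigr => c _ do under eq_bigr => d _ do
    rewrite linearZ /= polarization_comp scalerDr.
  under eq_bigr => c _ do rewrite big_split /=.
  rewrite big_split; congr (_ + _).
  rewrite (bigD1 b) //= [X in _ + X]big1 ?addr0 => [|c /negPf cb].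
    by apply: eq_bigr => d _; rewrite eqxx scale1r.
  by apply: big1 => d _; rewrite eq_sym cb scale0r scaler0.
under [X in _ = X - _]eq_bigr => a _ do under eq_bigr => b _ do rewrite E.
under [X in _ = X - _]eq_bigr => a _ do rewrite big_split /=.
(* The first-order terms, collected into the matrix C C, cancel against the subtracted sum; only
   normally ordered terms remain to be matched. *)
rewrite big_split /= -addrA [X in _ + X](_ : _ = 0) ?addr0; last first.
  apply/eqP; rewrite subr_eq0; apply/eqP; apply: eq_bigr => a _.
  rewrite exchange_big; apply: eq_bigr => d _ /=.
  by rewrite mxE scaler_suml.
rewrite pair_bigA /=.
under eq_bigr => p _ do rewrite /pairing /pairing_diff big_distrlr /=.
rewrite exchange_big; apply: eq_bigr => a _ /=.
rewrite exchange_big; apply: eq_bigr => b _ /=.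
under eq_bigr => p _ do rewrite big_distrlr /=.
rewrite exchange_big; apply: eq_bigr => c _ /=.
rewrite exchange_big; apply: eq_bigr => d _ /=.
rewrite pair_bigA scaler_sumr; apply: eq_bigr => p _ /=.
by rewrite -scalerAl -scalerAr scalerA.
Qed.

Lemma conj_polarization1 a b f : conj_polarization 1%:M a b f = polarization a b f.
Proof.
rewrite /conj_polarization (bigD1 a) //= (bigD1 b) //= !mxE !eqxx mulr1 scale1r.
rewrite !big1 ?addr0 // => [c ca|d db].
  by apply: big1 => d _; rewrite mxE eq_sym (negPf ca) mul0r scale0r.
by rewrite [X in _ * X]mxE eq_sym (negPf db) mulr0 scale0r.
Qed.

(** The adjoint of x_ia d/dx_ib is x_ib d/dx_ia, by applying [fischer_varl] to both factors. *)
Lemma fischer_polarization a b f g :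
  fischer (polarization a b f) g = fischer f (polarization b a g).
Proof.
rewrite fischerC !raddf_sum /=; apply: eq_bigr => i _.
by rewrite fischerC fischer_varl [RHS]fischerC fischer_varl fischerC.
Qed.

Lemma fischer_conj_polarization C a b f g :
  fischer (conj_polarization C a b f) g
  = \sum_c \sum_d C a c * C b d * fischer (polarization c d f) g.
Proof.
rewrite fischerC raddf_sum; apply: eq_bigr => c _ /=.
rewrite raddf_sum; apply: eq_bigr => d _ /=.
by rewrite fischerZr fischerC.
Qed.

Variable K : 'M[R]_m.
Hypotheses (Ktr : K^T = - K) (KK : K *m K = - 1%:M).

(* Twice the projection of [polarization] onto the operators commuting with K. *)
Definition hermitian_polarization a b f : {mpoly R[n]} :=
  polarization a b f + conj_polarization K a b f.

(** An elementary antisymmetric matrix made to commute with [K] by adding its conjugate: as K K =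
    -1, conjugation by [K] exchanges the two summands. *)
Definition unitary_generator a b : 'M[R]_m :=
  let Z := delta_mx a b - delta_mx b a in Z + K *m Z *m K^T.

Lemma unitary_generator_antisym a b :
  (unitary_generator a b)^T = - unitary_generator a b.
Proof.
rewrite /unitary_generator; set Z := _ - _.
have Zt : Z^T = - Z by rewrite linearB /= !trmx_delta opprB.
by rewrite linearD /= !trmx_mul trmxK Zt mulNmx mulmxN mulmxA [RHS]opprD.
Qed.

Lemma unitary_generator_comm a b :
  unitary_generator a b *m K = K *m unitary_generator a b.
Proof.
rewrite /unitary_generator /=; move: (_ - _) => Z.
rewrite Ktr mulmxDl mulmxDr !mulmxN mulNmx !mulmxA KK -!mulmxA KK !mulNmx mul1mx.
by rewrite !mulmxN mulmx1 !opprK addrC.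
Qed.

Lemma linear_flowD Y Z f :
  linear_flow (Y + Z) f = linear_flow Y f + linear_flow Z f.
Proof.
rewrite /linear_flow -big_split; apply: eq_bigr => a _; rewrite -big_split.
by apply: eq_bigr => b _; rewrite mxE scalerDl.
Qed.

Lemma linear_flowZl c Y f : linear_flow (c *: Y) f = c *: linear_flow Y f.
Proof.
rewrite /linear_flow scaler_sumr; apply: eq_bigr => a _; rewrite scaler_sumr.
by apply: eq_bigr => b _; rewrite mxE scalerA.
Qed.

Lemma linear_flow_hermitian a b f :
  linear_flow (delta_mx a b + K *m delta_mx a b *m K^T) f
  = hermitian_polarization b a f.
Proof.
rewrite linear_flowD; congr (_ + _).
  rewrite /linear_flow (bigD1 a) //= (bigD1 b) //= mxE !eqxx scale1r.
  rewrite !big1 ?addr0 // => [c ca|d db].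
    by apply: big1 => d _; rewrite mxE (negPf ca) scale0r.
  by rewrite mxE (negPf db) andbF scale0r.
rewrite /linear_flow /conj_polarization exchange_big /=.
apply: eq_bigr => c _; apply: eq_bigr => d _; congr (_ *: _).
rewrite mxE (bigD1 b) //= big1 ?addr0 => [|e eb]; last first.
  rewrite mxE big1 ?mul0r // => k _.
  by rewrite mxE (negPf eb) andbF mulr0.
rewrite !mxE (bigD1 a) //= big1 ?addr0 => [|e ea]; last first.
  by rewrite mxE (negPf ea) mulr0.
rewrite mxE !eqxx mulr1 mulrC.
move/matrixP: Ktr => Kt; have := Kt c b; have := Kt d a; rewrite !mxE => -> ->.
by rewrite mulrNN.
Qed.

(** The flow of [unitary_generator a b] is exactly h_ba - h_ab. *)
Lemma hermitian_polarization_sym a b f :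
  linear_flow (unitary_generator a b) f = 0 ->
  hermitian_polarization a b f = hermitian_polarization b a f.
Proof.
have -> : unitary_generator a b
    = delta_mx a b + K *m delta_mx a b *m K^T
      + (-1) *: (delta_mx b a + K *m delta_mx b a *m K^T).
  by rewrite /unitary_generator scaleN1r mulmxBr mulmxBl opprD addrACA.
rewrite linear_flowD linear_flowZl !linear_flow_hermitian scaleN1r.
by move/eqP; rewrite subr_eq0 => /eqP.
Qed.

(** The operator T, summed over ordered pairs. The pairs (i, j) and (j, i) contribute equally, since
    q and -q give the same q q(d). *)
Definition casimir f : {mpoly R[n]} :=
  \sum_i \sum_j (pairing 1%:M i j * pairing_diff 1%:M i j f
                 + pairing K i j * pairing_diff K i j f).

Lemma casimir_is_linear : linear casimir.
Proof.
move=> c f g; rewrite /casimir scaler_sumr -big_split; apply: eq_bigr => i _ /=.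
rewrite scaler_sumr -big_split; apply: eq_bigr => j _ /=.
by rewrite !linearP !mulrDr -!scalerAr scalerDr addrACA.
Qed.

HB.instance Definition _ :=
  GRing.isLinear.Build R {mpoly R[n]} {mpoly R[n]} _ casimir casimir_is_linear.

(** The first-order terms left by [sum_pairing_diff] for 1 and for [K] have coefficient matrices 1
    and K K = -1, and cancel. *)
Lemma casimirE f :
  casimir f = \sum_a \sum_b polarization a b (hermitian_polarization a b f).
Proof.
rewrite /casimir; under eq_bigr => i _ do rewrite big_split /=.
rewrite big_split /= !sum_pairing_diff mulmx1 KK.
under [X in X - _ + _]eq_bigr => a _ do under eq_bigr => b _ do
  rewrite conj_polarization1.
rewrite addrACA -opprD [X in _ - X](_ : _ = 0) ?subr0; last first.
  rewrite -big_split big1 // => a _; rewrite -big_split big1 // => b _ /=.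
  by rewrite -scalerDl [X in _ + X]mxE subrr scale0r.
rewrite -big_split; apply: eq_bigr => a _; rewrite -big_split; apply: eq_bigr => b _.
by rewrite /hermitian_polarization raddfD.
Qed.

Lemma K_orth a b : \sum_c K c a * K c b = (a == b)%:R.
Proof.
transitivity ((K^T *m K) a b); last by rewrite Ktr mulNmx KK opprK mxE.
by rewrite mxE; apply: eq_bigr => c _; rewrite mxE.
Qed.

(** [K] is orthogonal, so K e K^T has the same trace as e, and the trace of e is the Euler
    operator. *)
Lemma sum_hermitian_polarization_diag f :
  \sum_a hermitian_polarization a a f = 2%:R *: \sum_(k < n) 'X_k * f^`M(k).
Proof.
have E : \sum_a polarization a a f = \sum_(k < n) 'X_k * f^`M(k).
  rewrite /polarization exchange_big pair_bigA /=.
  by rewrite [RHS](reindex _ (onW_bij _ x_bij)).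
rewrite big_split /= E scaler_nat mulr2n; congr (_ + _); rewrite -E.
rewrite /conj_polarization exchange_big; apply: eq_bigr => c _ /=.
rewrite exchange_big (bigD1 c) //= [X in _ + X]big1 ?addr0 => [|d dc].
  by rewrite -scaler_suml K_orth eqxx scale1r.
by rewrite -scaler_suml K_orth eq_sym (negPf dc) scale0r.
Qed.

(** K^T h K = h: the summand e becomes K^T e K = K e K^T, and K e K^T becomes e. *)
Lemma sum_conj_hermitian_polarization c d f :
  \sum_a \sum_b (K a c * K b d) *: hermitian_polarization a b f
  = hermitian_polarization c d f.
Proof.
under eq_bigr => a _ do under eq_bigr => b _ do rewrite scalerDr.
under eq_bigr => a _ do rewrite big_split /=.
rewrite big_split /= addrC /hermitian_polarization; congr (_ + _).
  transitivity (\sum_e \sum_k ((\sum_a K a c * K a e) * (\sum_b K b d * K b k))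
     *: polarization e k f); last first.
    rewrite -conj_polarization1; apply: eq_bigr => e _; apply: eq_bigr => k _.
    by rewrite !K_orth !mxE.
  rewrite /conj_polarization pair_bigA /=.
  under eq_bigr => p _ do rewrite scaler_sumr.
  rewrite exchange_big; apply: eq_bigr => e _ /=.
  under eq_bigr => p _ do rewrite scaler_sumr.
  rewrite exchange_big; apply: eq_bigr => k _ /=.
  rewrite big_distrlr pair_bigA scaler_suml; apply: eq_bigr => p _ /=.
  by rewrite scalerA mulrACA.
apply: eq_bigr => a _; apply: eq_bigr => b _; congr (_ *: _).
move/matrixP: Ktr => Kt; have := Kt c a; have := Kt d b; rewrite !mxE => -> ->.
by rewrite mulrNN.
Qed.

(** Adjointness and the symmetry of h f turn <f, T f> into the sum of <e_ab f, h_ab f>. Half of the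
    sum of squares |h_ab f|^2 equals this, so every square vanishes. *)
Lemma casimir_eq0 f :
  (forall a b, hermitian_polarization a b f = hermitian_polarization b a f) ->
  casimir f = 0 -> forall a b, hermitian_polarization a b f = 0.
Proof.
move=> fsym f0.
have E : \sum_a \sum_b fischer (polarization a b f) (hermitian_polarization a b f) = 0.
  transitivity (fischer f (casimir f)); last by rewrite f0 raddf0.
  rewrite casimirE raddf_sum exchange_big; apply: eq_bigr => a _ /=.
  rewrite raddf_sum; apply: eq_bigr => b _ /=.
  by rewrite -fischer_polarization fsym.
(* One factor h is split as e + K e K^T. In the second part the two matrices [K] are moved over to
   the other factor h, which absorbs them, so both parts equal the sum [E]. *)
have S : \sum_a \sum_b
    fischer (hermitian_polarization a b f) (hermitian_polarization a b f) = 0.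
  transitivity (\sum_a \sum_b
      (fischer (polarization a b f) (hermitian_polarization a b f)
       + fischer (conj_polarization K a b f) (hermitian_polarization a b f))).
    apply: eq_bigr => a _; apply: eq_bigr => b _.
    rewrite {1}/hermitian_polarization fischerC raddfD /=.
    by rewrite !(fischerC _ (hermitian_polarization _ _ _)).
  under eq_bigr => a _ do rewrite big_split /=.
  rewrite big_split /= E add0r pair_bigA /=.
  under eq_bigr => p _ do rewrite fischer_conj_polarization.
  rewrite exchange_big -[RHS]E; apply: eq_bigr => c _ /=.
  rewrite exchange_big; apply: eq_bigr => d _ /=.
  rewrite -sum_conj_hermitian_polarization raddf_sum /= -(pair_bigA _ (fun a b =>
    K a c * K b d * fischer (polarization c d f) (hermitian_polarization a b f))) /=.
  apply: eq_bigr => a _; rewrite raddf_sum; apply: eq_bigr => b _ /=.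
  by rewrite fischerZr.
move=> a b; apply: fischer_eq0.
move/eqP: S; rewrite psumr_eq0 => [|c _]; last by apply: sumr_ge0 => *; apply: fischer_ge0.
move=> /allP/(_ a (mem_index_enum _))/=; rewrite psumr_eq0 => [|*]; last exact: fischer_ge0.
by move=> /allP/(_ b (mem_index_enum _))/eqP.
Qed.

End Casimir.

(** * Generation of the invariants by induction on the degree *)

Section FirstFundamentalTheorem.
Variables (R : realFieldType) (n m : nat) (I : finType).
Variable (x : I -> 'I_m -> 'I_n.+1).
Hypothesis x_bij : bijective (fun p => x p.1 p.2).
Variable K : 'M[R]_m.
Hypotheses (Ktr : K^T = - K) (KK : K *m K = - 1%:M).
Implicit Types (f g : {mpoly R[n.+1]}) (Y C : 'M[R]_m).

Local Notation polarization := (@polarization R n.+1 m I x).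
Local Notation linear_flow := (@linear_flow R n.+1 m I x).
Local Notation pairing := (@pairing R n.+1 m I x).
Local Notation pairing_diff := (@pairing_diff R n.+1 m I x).
Local Notation casimir := (@casimir R n.+1 m I x K).

Lemma dhomog_polarization d a b f :
  f \is d.-homog -> polarization a b f \is d.-homog.
Proof.
case: d => [/dhomog0E ->|d fd]; last first.
  rewrite rpred_sum // => i _; rewrite -(add1n d) dhomogM //.
    by rewrite dhomogX /= mdeg1.
  exact: (dhomog_mderiv _ fd).
rewrite [polarization _ _ _]big1 ?rpred0 // => i _.
by rewrite mderivZ -mpolyC1 mderivC scaler0 mulr0.
Qed.

Lemma dhomog_linear_flow d Y f : f \is d.-homog -> linear_flow Y f \is d.-homog.
Proof.
move=> fd; rewrite rpred_sum // => a _; rewrite rpred_sum // => b _.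
by rewrite rpredZ // dhomog_polarization.
Qed.

Lemma dhomog_pairing C i j : pairing C i j \is 2.-homog.
Proof.
rewrite rpred_sum // => a _; rewrite rpred_sum // => b _; rewrite rpredZ //.
by rewrite (@dhomogM _ _ _ 1 _ 1) // dhomogX /= mdeg1.
Qed.

Lemma dhomog_pairing_diff C d i j f :
  f \is d.-homog -> pairing_diff C i j f \is d.-2.-homog.
Proof.
move=> fd; rewrite rpred_sum // => a _; rewrite rpred_sum // => b _.
by rewrite rpredZ //; do 2! apply: dhomog_mderiv.
Qed.

Lemma dhomog_casimir d f : f \is d.-homog -> casimir f \is d.-homog.
Proof.
move=> fd; rewrite casimirE // rpred_sum // => a _; rewrite rpred_sum // => b _.
apply: dhomog_polarization; rewrite rpredD ?dhomog_polarization //.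
rewrite rpred_sum // => c _; rewrite rpred_sum // => e _.
by rewrite rpredZ // dhomog_polarization.
Qed.

(** A linear flow preserves degrees, so infinitesimal invariance passes to homogeneous
    components. *)
Lemma pihomog_linear_flow d Y f :
  pihomog mdeg d (linear_flow Y f) = linear_flow Y (pihomog mdeg d f).
Proof.
have fh e := dhomog_linear_flow Y (pihomogP mdeg e f).
(* The bound exceeds [d] so that degree [d] occurs in the decomposition even when it is larger than
   the degree of [f]. *)
pose k := (maxn (msize f) d.+1); have dk : (d < k)%N by rewrite leq_maxr.
rewrite {1}(@pihomog_partitionE _ _ mdeg k f) ?leq_maxl //.
rewrite (raddf_sum (linear_flow Y)) (raddf_sum (pihomog mdeg d)).
rewrite (bigD1 (Ordinal dk)) //= (pihomog_dE (fh d)) big1 ?addr0 // => e ed.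
by apply: pihomog_ne0 (fh e); apply: contra ed => /eqP ed; apply/eqP/val_inj.
Qed.

Lemma linear_flow_casimir Y f : Y^T = - Y -> Y *m K = K *m Y ->
  linear_flow Y f = 0 -> linear_flow Y (casimir f) = 0.
Proof.
move=> Yt YK Yf; rewrite raddf_sum big1 // => i _; rewrite raddf_sum big1 // => j _ /=.
rewrite raddfD /= !linear_flowM // !linear_flow_pairing // ?linear_flow_pairing_diff //.
- by rewrite !mulr0 !mul0r !addr0.
- by rewrite Yt YK mulmxN addNr.
- by rewrite Yt mulmx1 mul1mx addNr.
- by rewrite Yt mulNmx YK addNr.
- by rewrite Yt mulmx1 mul1mx addNr.
Qed.

(** The predicate [P] stands for any subalgebra containing the quadratic invariants, which is the
    form in which a smallest subalgebra is used later. *)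
Theorem unitary_fft (P : {mpoly R[n.+1]} -> Prop) f :
  P 1 -> (forall c g h, P g -> P h -> P (c *: g + h)) ->
  (forall g h, P g -> P h -> P (g * h)) ->
  (forall i j, P (pairing 1%:M i j)) -> (forall i j, P (pairing K i j)) ->
  (forall Y, Y^T = - Y -> Y *m K = K *m Y -> linear_flow Y f = 0) ->
  P f.
Proof.
move=> P1 PZD PM PG PK.
have P0 : P 0 by rewrite -(subrr 1) -scaleN1r addrC; apply: PZD.
have PD g h : P g -> P h -> P (g + h) by rewrite -{2}[g]scale1r; apply: PZD.
have Psum (J : finType) (F : J -> {mpoly R[n.+1]}) :
  (forall j, P (F j)) -> P (\sum_j F j).
  by move=> PF; elim/big_ind: _.
(* Finitely many flows replace the condition on all [Y]: they already force the symmetry of h, and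
   [dhomog_inj_surj] needs a finite family of kernels. *)
pose gen p : 'M[R]_m := unitary_generator K p.1 p.2.
have gen_t p : (gen p)^T = - gen p := unitary_generator_antisym K p.1 p.2.
have gen_K p : gen p *m K = K *m gen p := unitary_generator_comm Ktr KK p.1 p.2.
have Phomog d g : g \is d.-homog ->
    (forall p, linear_flow (gen p) g = 0) -> P g.
  elim/ltn_ind: d g => -[_ g /dhomog0E -> _|d IHd g gd Dg].
    by rewrite -[_ *: _]addr0; apply: PZD P1 P0.
  pose D p : {linear {mpoly R[n.+1]} -> {mpoly R[n.+1]}} := linear_flow (gen p).
  have [||||h [hd Dh ->]] := @dhomog_inj_surj R n d.+1 _ D casimir _ _ _ _ g gd Dg.
  - by move=> p h; apply: dhomog_linear_flow.
  - exact: dhomog_casimir.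
  - by move=> h Dh p; apply: linear_flow_casimir (Dh p).
  - move=> h hd Dh Th.
    have h_sym a b := hermitian_polarization_sym Ktr (Dh (a, b)).
    have := sum_hermitian_polarization_diag x_bij Ktr KK h.
    rewrite (euler_homog hd) big1 => [|a _]; last exact: casimir_eq0 Th _ _.
    by move/esym/eqP; rewrite !scaler_eq0 !pnatr_eq0 /= => /eqP.
  apply: (Psum) => i; apply: Psum => j.
  (* Two derivatives lead from degree [d.+1] to [d.-1]; in degree 1 the truncation is harmless, as
     they give 0. *)
  have dd : (d.-1 < d.+1)%N by rewrite ltnS leq_pred.
  apply: PD; apply: PM => //; apply: (IHd _ dd);
    do ?[exact: (dhomog_pairing_diff _ _ _ hd)];
    move=> p; apply: linear_flow_pairing_diff => //.
  - by rewrite [_^T]gen_t mulmx1 mul1mx addNr.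
  - exact: Dh.
  - by rewrite [_^T]gen_t [_ *m K]gen_K mulmxN addNr.
  - exact: Dh.
move=> Df; rewrite (pihomog_partitionE (leqnn (msize f))).
apply: Psum => d; apply: (Phomog d); first exact: pihomogP.
by move=> p; rewrite -pihomog_linear_flow Df ?raddf0.
Qed.

End FirstFundamentalTheorem.

(** * The group G and its one-parameter subgroups *)

Section Exponential.
Variables (R : realType) (n : nat).
Implicit Types (J K : 'M[R]_n.+1).

(** Euler's formula term by term: [cos_coeff] vanishes at odd [k] and [sin_coeff] at even [k]. *)
Lemma exp_coeff_complex_structure J (t : R) k : J * J = -1 ->
  (k`!%:R)^-1 *: (t ^+ k *: J ^+ k) = (cos_coeff t k)%:A + sin_coeff t k *: J.
Proof.
move=> JJ; have J2 l : J ^+ l.*2 = ((-1) ^+ l)%:A.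
  by rewrite -mul2n exprM expr2 JJ -[X in X ^+ _](@scaleN1r R) exprZn expr1n.
rewrite /cos_coeff /sin_coeff /= -exprnP.
rewrite -(odd_double_half k); case: (odd k); move: k./2 => l; rewrite ?add0n ?add1n.
  rewrite /= odd_double /= uphalf_double doubleK !mul0r scale0r add0r [J ^+ _]exprS J2.
  by rewrite -scalerAr mulr1 !scalerA; congr (_ *: _); ring.
rewrite /= odd_double /= doubleK !mul0r scale0r addr0 J2 !scalerA.
by congr (_ *: _); ring.
Qed.

(** As (J K)^2 = 1, the space splits into two parts on which a J + b K is (a - b) J and (a + b) J.
    On each the series is Euler's, and the addition formulas for [cos] and [sin] reassemble the
    product. *)
Lemma expmx_commuting J K (a b : R) :
  J * J = -1 -> K * K = -1 -> J * K = K * J ->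
  expmx (a *: J + b *: K) = ((cos a)%:A + sin a *: J) * ((cos b)%:A + sin b *: K).
Proof.
move=> JJ KK JK.
have h2 (x : 'M[R]_n.+1) : 2^-1 *: (x + x) = x.
  by rewrite -[RHS]scale1r scalerDr -scalerDl; congr (_ *: _); lra.
(* [P1] and [P2] are complementary projections, with K = - J on the image of
   [P1] and K = J on that of [P2]. *)
pose P1 := 2^-1 *: (1 + J * K); pose P2 := 2^-1 *: (1 - J * K).
have JKJK : J * K * (J * K) = 1.
  by rewrite {2}JK !mulrA -(mulrA J) KK mulrN1 mulNr JJ opprK.
have P1J : J * P1 = P1 * J.
  by rewrite -scalerAr -scalerAl mulrDl mulrDr mul1r mulr1 -mulrA -JK.
have P2J : J * P2 = P2 * J.
  by rewrite -scalerAr -scalerAl mulrBl mulrBr mul1r mulr1 -mulrA -JK.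
have P11 : P1 * P1 = P1.
  rewrite -scalerAr -scalerAl mulrDl !mulrDr !mul1r !mulr1 JKJK.
  by rewrite [J * K + 1]addrC h2.
have P22 : P2 * P2 = P2.
  rewrite -scalerAr -scalerAl mulrBl !mulrBr !mul1r !mulr1 JKJK.
  by rewrite opprB h2.
have P12 : P1 * P2 = 0.
  rewrite -scalerAr -scalerAl mulrDl !mulrBr !mul1r !mulr1 JKJK.
  by rewrite addrA subrK subrr !scaler0.
have P21 : P2 * P1 = 0.
  rewrite -scalerAr -scalerAl mulrBl !mulrDr !mul1r !mulr1 JKJK.
  by rewrite [J * K + 1]addrC subrr !scaler0.
have P1K : P1 * K = - (P1 * J).
  rewrite -!scalerAl -scalerN; congr (_ *: _).
  rewrite !mulrDl !mul1r -!mulrA KK -JK !mulrA JJ mulrN1 mulN1r opprD opprK.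
  exact: addrC.
have P2K : P2 * K = P2 * J.
  rewrite -!scalerAl; congr (_ *: _).
  rewrite !mulrBl !mul1r -!mulrA KK -JK !mulrA JJ mulrN1 mulN1r !opprK.
  exact: addrC.
have P12D : P1 + P2 = 1.
  by rewrite -scalerDr addrACA subrr addr0 h2.
have KP1 : K * P1 = P1 * K.
  by rewrite -scalerAl -scalerAr mulrDl mulrDr mul1r mulr1 mulrA -JK.
have KP2 : K * P2 = P2 * K.
  by rewrite -scalerAl -scalerAr mulrBl mulrBr mul1r mulr1 mulrA -JK.
clearbody P1 P2; set A := a *: J + b *: K.
have AP1 X : A * (P1 * X) = (a - b) *: (P1 * (J * X)).
  have P1A : P1 * A = (a - b) *: (P1 * J).
    by rewrite mulrDr -!scalerAr P1K scalerN scalerBl.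
  have -> : A * (P1 * X) = P1 * A * X.
    by rewrite mulrA mulrDl mulrDr -!scalerAl -!scalerAr P1J KP1.
  by rewrite P1A -scalerAl mulrA.
have AP2 X : A * (P2 * X) = (a + b) *: (P2 * (J * X)).
  have P2A : P2 * A = (a + b) *: (P2 * J).
    by rewrite mulrDr -!scalerAr P2K scalerDl.
  have -> : A * (P2 * X) = P2 * A * X.
    by rewrite mulrA mulrDl mulrDr -!scalerAl -!scalerAr P2J KP2.
  by rewrite P2A -scalerAl mulrA.
have Ak k : A ^+ k = (a - b) ^+ k *: (P1 * J ^+ k) + (a + b) ^+ k *: (P2 * J ^+ k).
  elim: k => [|k IH]; first by rewrite !expr0 !scale1r !mulr1 P12D.
  by rewrite [LHS]exprS IH mulrDr -!scalerAr AP1 AP2 !scalerA -!exprSr -!exprS.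
have term k : (k`!%:R)^-1 *: A ^+ k
    = cos_coeff (a - b) k *: P1 + sin_coeff (a - b) k *: (P1 * J)
      + (cos_coeff (a + b) k *: P2 + sin_coeff (a + b) k *: (P2 * J)).
  have E t P : (k`!%:R)^-1 *: (t ^+ k *: (P * J ^+ k))
      = cos_coeff t k *: P + sin_coeff t k *: (P * J).
    by rewrite !scalerAr exp_coeff_complex_structure // mulrDr -!scalerAr mulr1.
  by rewrite Ak scalerDr !E.
have cvgc t : series (cos_coeff t) @ \oo --> cos t.
  by rewrite cos.unlock; exact: is_cvg_series_cos_coeff.
have cvgs t : series (sin_coeff t) @ \oo --> sin t.
  by rewrite sin.unlock; exact: is_cvg_series_sin_coeff.
have -> : expmx A = cos (a - b) *: P1 + sin (a - b) *: (P1 * J)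
      + (cos (a + b) *: P2 + sin (a + b) *: (P2 * J)).
  apply: cvg_lim; first exact: norm_hausdorff.
  rewrite [X in X @ _ --> _](_ : _ = fun N =>
     series (cos_coeff (a - b)) N *: P1 + series (sin_coeff (a - b)) N *: (P1 * J)
      + (series (cos_coeff (a + b)) N *: P2 + series (sin_coeff (a + b)) N *: (P2 * J))).
    by apply: cvgD; apply: cvgD; apply: cvgZr_tmp;
      first [exact: cvgc | exact: cvgs].
  apply/funext => N; rewrite /series /= !scaler_suml -!big_split /=.
  by apply: eq_bigr => k _; rewrite term.
(* The claimed product is compared with the limit on each of the two parts separately, which
   suffices because P1 + P2 = 1. *)
have E1 : P1 * (((cos a)%:A + sin a *: J) * ((cos b)%:A + sin b *: K))
    = cos (a - b) *: P1 + sin (a - b) *: (P1 * J).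
  have P1JK : P1 * (J * K) = P1.
    by rewrite mulrA -P1J -mulrA P1K mulrN mulrA P1J -mulrA JJ mulrN1 opprK.
  rewrite mulrDl !mulrDr -!scalerAl -!scalerAr !mul1r !mulr1 P1JK P1K cosB sinB.
  rewrite !scalerA !scalerDl scaleNr scalerN.
  by rewrite [X in _ + X = _]addrC [X in _ = _ + X]addrC addrACA.
have E2 : P2 * (((cos a)%:A + sin a *: J) * ((cos b)%:A + sin b *: K))
    = cos (a + b) *: P2 + sin (a + b) *: (P2 * J).
  have P2JK : P2 * (J * K) = - P2.
    by rewrite mulrA -P2J -mulrA P2K mulrA P2J -mulrA JJ mulrN1.
  rewrite mulrDl !mulrDr -!scalerAl -!scalerAr !mul1r !mulr1 P2JK P2K cosD sinD.
  rewrite !scalerA !scalerDl scaleNr scalerN.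
  by rewrite [X in _ + X = _]addrC [X in _ = _ + X]addrC addrACA.
by rewrite -E1 -E2 -mulrDl P12D mul1r.
Qed.

End Exponential.

(** * Polynomial functions: differentiation along curves and vanishing *)

Section ChainRule.
Variables (R : realType) (n : nat).
Implicit Types (f : {mpoly R[n]}).

(** The polynomials satisfying the chain rule contain the constants and the variables and are closed
    under sums and products. *)
Lemma is_derive_meval f (c : 'I_n -> R -> R) (c' : 'I_n -> R) (t : R) :
  (forall k, is_derive t 1 (c k) (c' k)) ->
  is_derive t 1 (fun s => f.@[fun k => c k s])
    (\sum_k c' k * (f^`M(k)).@[fun k => c k t]).
Proof.
move=> dc.
pose Q (g : {mpoly R[n]}) := is_derive t 1 (fun s => g.@[fun k => c k s])
  (\sum_k c' k * (g^`M(k)).@[fun k => c k t]).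
have QC a : Q a%:MP.
  rewrite /Q (_ : (fun s => _) = cst a); last by apply/funext => s; rewrite mevalC.
  rewrite big1 => [|k _]; last by rewrite mderivC meval0 mulr0.
  exact: is_derive_cst.
have QX i : Q 'X_i.
  rewrite /Q (_ : (fun s => _) = c i); last by apply/funext => s; rewrite mevalXU.
  rewrite (bigD1 i) //= big1 ?addr0 => [|k ki]; last first.
    by rewrite mderivXU eq_sym (negPf ki) meval0 mulr0.
  by rewrite mderivXU eqxx meval1 mulr1.
have QD (g h : {mpoly R[n]}) : Q g -> Q h -> Q (g + h).
  rewrite /Q => dg dh.
  rewrite (_ : (fun s => _) = (fun s => g.@[fun k => c k s])
     + (fun s => h.@[fun k => c k s])); last by apply/funext => s; rewrite mevalD.
  apply: is_derive_eq; rewrite -big_split; apply: eq_bigr => k _ /=.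
  by rewrite mderivD mevalD mulrDr.
have QM (g h : {mpoly R[n]}) : Q g -> Q h -> Q (g * h).
  rewrite /Q => dg dh.
  rewrite (_ : (fun s => _) = (fun s => g.@[fun k => c k s])
     * (fun s => h.@[fun k => c k s])); last by apply/funext => s; rewrite mevalM.
  apply: is_derive_eq; rewrite /GRing.scale /= !mulr_sumr -big_split /=.
  by apply: eq_bigr => k _; rewrite mderivM mevalD !mevalM; ring.
have Q1 : Q 1 := QC 1.
rewrite -/(Q f); elim/mpolyind: f => [|a m f _ _ IH]; first exact: (QC 0).
apply: QD => //; rewrite -mul_mpolyC; apply: (QM) => //.
rewrite mpolyXE_id; apply: (big_ind Q Q1 QM) => k _.
by elim: (m k) => [|l IHl]; rewrite ?expr0 // exprS; apply: QM.
Qed.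

Lemma meval_at0 f : f.@[fun=> 0] = f@_0.
Proof.
elim/mpolyind: f => [|a m f _ _ IH]; first by rewrite meval0 mcoeff0.
rewrite mevalD mevalZ mcoeffD mcoeffZ IH mevalX mcoeffX; congr (_ * _ + _).
have [->|m0] := eqVneq m 0%MM; first by rewrite big1 // => i _; rewrite mnm0E expr0.
apply/eqP; apply/prodf_eq0; have /existsP[i mi] : [exists i, m i != 0%N].
  by apply: contraNT m0; rewrite negb_exists => /forallP m0; apply/eqP/mnmP => i;
     rewrite mnm0E; apply/eqP; have := m0 i; rewrite negbK.
by exists i => //; rewrite expr0n (negPf mi).
Qed.

(** Differentiating along coordinate lines shows that every derivative of [f] vanishes everywhere
    too; at 0 the derivative of order m is a positive multiple of the coefficient at m. *)
Lemma meval_eq0 f : (forall v, f.@[v] = 0) -> f = 0.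
Proof.
move=> f0.
have deriv0 (g : {mpoly R[n]}) : (forall v, g.@[v] = 0) -> forall k v, (g^`M(k)).@[v] = 0.
  move=> g0 k v.
  have dc (l : 'I_n) : is_derive (0 : R) 1 (fun s => v l + (l == k)%:R * s) ((l == k)%:R).
    by apply: is_derive_eq; rewrite /GRing.scale /= add0r mul1r mulr1.
  have := is_derive_meval g dc.
  rewrite (_ : (fun s => _) = cst 0); last by apply/funext.
  move=> [_]; rewrite derive_cst (bigD1 k) //= big1 => [|l /negPf ->]; last by rewrite mul0r.
  rewrite eqxx mul1r addr0 => ->; apply: meval_eq => l.
  by rewrite mulr0 addr0.
have derivm0 m (g : {mpoly R[n]}) : (forall v, g.@[v] = 0) -> forall v, (g^`M[m]).@[v] = 0.
  move=> g0; rewrite mderivm_foldr; elim: (flatten _) => //= k s IH.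
  by move=> v; apply: deriv0.
apply/mpolyP => m; rewrite mcoeff0; have := derivm0 m f f0 (fun=> 0).
rewrite meval_at0 mcoeff_mderivm addm0 => /eqP.
rewrite -mulr_natr mulf_eq0 pnatr_eq0 -leqn0 leqNgt prodn_gt0 ?orbF => [/eqP //|i].
by rewrite ffact_gt0.
Qed.

End ChainRule.

(** * Elements of G as products of rotations, and its Lie algebra *)

Section SymmetryGroup.
Variable R : realType.
Implicit Types (L u : 'cV[R]_3) (S Y : 'M[R]_4).

Local Notation K := (K_mx R).

Lemma forall_ord4 (P : 'I_4 -> Prop) : P 0 -> P 1 -> P 2 -> P 3 -> forall i, P i.
Proof.
move=> P0 P1 P2 P3; case=> [[|[|[|[|//]]]] lti].
- by rewrite (_ : Ordinal lti = 0) //; apply: val_inj.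
- by rewrite (_ : Ordinal lti = 1) //; apply: val_inj.
- by rewrite (_ : Ordinal lti = 2) //; apply: val_inj.
- by rewrite (_ : Ordinal lti = 3) //; apply: val_inj.
Qed.

Lemma sum_ord4 (V : nmodType) (F : 'I_4 -> V) : \sum_i F i = F 0 + F 1 + F 2 + F 3.
Proof.
rewrite !big_ord_recl big_ord0 addr0 !addrA.
by congr (F _ + F _ + F _ + F _); apply: val_inj.
Qed.

Lemma isoc_rows L : isoc L = mx_of_rows 4 4
  [:: [::   0    ; - L 2 0;   L 1 0; - L 0 0];
      [::   L 2 0;   0    ; - L 0 0; - L 1 0];
      [:: - L 1 0;   L 0 0;   0    ; - L 2 0];
      [::   L 0 0;   L 1 0;   L 2 0;   0    ]].
Proof.
have e0 : (0 : 'I_4) = lshift 1 (0 : 'I_3) by apply: val_inj.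
have e1 : (1 : 'I_4) = lshift 1 (1 : 'I_3) by apply: val_inj.
have e2 : (2 : 'I_4) = lshift 1 (2 : 'I_3) by apply: val_inj.
have e3 : (3 : 'I_4) = rshift 3 (0 : 'I_1) by apply: val_inj.
apply/matrixP; apply: forall_ord4; apply: forall_ord4; rewrite [RHS]mxE /=;
  by rewrite ?e3 ?e2 ?e1 ?e0 ?block_mxEul ?block_mxEur ?block_mxEdl ?block_mxEdr !mxE.
Qed.

Lemma K_antisym : K^T = - K.
Proof.
by apply/matrixP; apply: forall_ord4; apply: forall_ord4; rewrite !mxE /= ?opprK ?oppr0.
Qed.

Lemma K_sqr : K *m K = - 1%:M.
Proof.
apply/matrixP; apply: forall_ord4; apply: forall_ord4;
  by rewrite !mxE sum_ord4 !mxE /=; ring.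
Qed.

Lemma isoc_antisym L : (isoc L)^T = - isoc L.
Proof.
rewrite isoc_rows; apply/matrixP; apply: forall_ord4; apply: forall_ord4;
  by rewrite !mxE /= ?opprK ?oppr0.
Qed.

(** The algebra so(4) is the sum of two commuting copies of so(3), the left and right isoclinic
    ones; [isoc] parametrises one of them and [K] lies in the other. *)
Lemma isoc_K L : isoc L *m K = K *m isoc L.
Proof.
rewrite isoc_rows; apply/matrixP; apply: forall_ord4; apply: forall_ord4;
  by rewrite !mxE !sum_ord4 !mxE /=; ring.
Qed.

Lemma isoc_sqr L :
  isoc L *m isoc L = - (L 0 0 ^+ 2 + L 1 0 ^+ 2 + L 2 0 ^+ 2)%:M.
Proof.
rewrite isoc_rows; apply/matrixP; apply: forall_ord4; apply: forall_ord4;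
  by rewrite !mxE !sum_ord4 !mxE /=; ring.
Qed.

Lemma isocZ c L : isoc (c *: L) = c *: isoc L.
Proof.
rewrite !isoc_rows; apply/matrixP; apply: forall_ord4; apply: forall_ord4;
  by rewrite !mxE /= ?mulr0 // mulrN.
Qed.

Lemma isoc_polar L : exists c u, L = c *: u /\ isoc u *m isoc u = - 1%:M.
Proof.
pose s := L 0 0 ^+ 2 + L 1 0 ^+ 2 + L 2 0 ^+ 2.
have s_ge0 : 0 <= s by rewrite !addr_ge0 ?sqr_ge0.
have [s0|s0] := eqVneq s 0.
  (* For L = 0 there is no direction to normalise, and any unit vector serves. *)
  exists 0, (\col_i (i == 0)%:R); split.
    rewrite scale0r; apply/colP => i; rewrite mxE.
    move/eqP: s0; rewrite /s paddr_eq0 ?addr_ge0 ?sqr_ge0 // paddr_eq0 ?sqr_ge0 //.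
    rewrite !sqrf_eq0 => /andP[/andP[/eqP L0 /eqP L1] /eqP L2].
    case: i => [[|[|[|//]]] lti];
      [rewrite -[RHS]L0|rewrite -[RHS]L1|rewrite -[RHS]L2];
      by congr (L _ _); apply: val_inj.
  by rewrite isoc_sqr !mxE /= expr1n !expr0n /= !addr0.
have q0 : Num.sqrt s != 0 by rewrite sqrtr_eq0 -ltNge lt_def s0.
exists (Num.sqrt s), ((Num.sqrt s)^-1 *: L); split.
  by rewrite scalerA mulfV // scale1r.
rewrite isoc_sqr !mxE !exprMn -!mulrDr -/s exprVn sqr_sqrtr //.
by rewrite mulVf.
Qed.

(** The parameters are doubled to cancel the factor 1/2 in the exponent. *)
Lemma expmx_generator u (a b : R) : isoc u *m isoc u = - 1%:M ->
  expmx (2^-1 *: (isoc ((2 * a) *: u) + (2 * b) *: K))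
  = ((cos a)%:A + sin a *: isoc u) *m ((cos b)%:A + sin b *: K).
Proof.
move=> uu; rewrite isocZ scalerDr !scalerA !mulKf ?pnatr_eq0 //.
exact: expmx_commuting uu K_sqr (isoc_K u).
Qed.

Lemma G_rotations S : G S -> exists u (a b : R), isoc u *m isoc u = - 1%:M /\
  S = ((cos a)%:A + sin a *: isoc u) *m ((cos b)%:A + sin b *: K).
Proof.
move=> [L [tau ->]]; have [c [u [-> uu]]] := isoc_polar L.
exists u, (c / 2), (tau / 2); split=> //; rewrite -expmx_generator //.
by rewrite ![2 * (_ / 2)]mulrC !divfK ?pnatr_eq0.
Qed.

Lemma rotation_orth n (J : 'M[R]_n.+1) a : J^T = - J -> J *m J = - 1%:M ->
  ((cos a)%:A + sin a *: J)^T *m ((cos a)%:A + sin a *: J) = 1%:M.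
Proof.
move=> Jt JJ; have -> : ((cos a)%:A + sin a *: J)^T = (cos a)%:A + sin a *: - J.
  by rewrite -Jt; apply/matrixP => i j; rewrite !mxE eq_sym.
rewrite scalerN mulmxDl !mulmxDr !mulNmx -!scalemxAl -!scalemxAr !mul1mx !mulmx1 JJ.
rewrite scalerN scalerN opprK !scalerA addrA [sin a * cos a]mulrC addrK.
by rewrite -scalerDl -!expr2 cos2Dsin2 scale1r.
Qed.

Lemma G_orth S : G S -> S^T *m S = 1%:M.
Proof.
move=> /G_rotations [u [a [b [uu ->]]]].
rewrite trmx_mul mulmxA -[X in X *m _]mulmxA rotation_orth ?isoc_antisym //.
by rewrite mulmx1 rotation_orth ?K_antisym ?K_sqr.
Qed.

Lemma G_comm S : G S -> S *m K = K *m S.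
Proof.
move=> /G_rotations [u [a [b [_ ->]]]].
rewrite -mulmxA [X in _ *m X](_ : _ = K *m ((cos b)%:A + sin b *: K)).
  rewrite !mulmxA; congr (_ *m _); rewrite mulmxDl mulmxDr.
  by rewrite -!scalemxAl -!scalemxAr isoc_K mulmx1 mul1mx.
by rewrite mulmxDl mulmxDr -!scalemxAl -!scalemxAr mulmx1 mul1mx.
Qed.

Lemma rotation_in_G u t : isoc u *m isoc u = - 1%:M ->
  G ((cos t)%:A + sin t *: isoc u).
Proof.
move=> uu; exists ((2 * t) *: u), (2 * 0).
by rewrite expmx_generator // cos0 sin0 !scale0r scale1r addr0 mulmx1.
Qed.

Lemma rotation_K_in_G t : G ((cos t)%:A + sin t *: K).
Proof.
(* Any unit [u] will do, as its coefficient is 0; it is kept so that [expmx_generator] applies. *)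
have [c [u [_ uu]]] := isoc_polar 0; exists ((2 * 0) *: u), (2 * t).
by rewrite expmx_generator // cos0 sin0 !scale0r scale1r addr0 mul1mx.
Qed.

(** This identifies the matrices required by [unitary_fft] with the exponents that occur in G. *)
Lemma antisym_comm_isoc Y : Y^T = - Y -> Y *m K = K *m Y ->
  exists L (t : R), Y = isoc L + t *: K.
Proof.
move=> Yt YK.
have E i j : Y i j = - Y j i by move/matrixP/(_ j i): Yt; rewrite !mxE.
have D i : Y i i = 0 by have := E i i; lra.
have E01 := E 1 0; have E02 := E 2 0; have E03 := E 3 0.
have E12 := E 2 1; have E13 := E 3 1; have E23 := E 3 2.
move/matrixP: YK => YK; have := YK 0 2; have := YK 0 1.
have D0 := D 0; have D1 := D 1; have D2 := D 2; have D3 := D 3.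
rewrite !mxE !sum_ord4 !mxE /= => C1 C2.
(* Read off from [isoc L + t *: K]: its entries (0, 3) and (1, 2) are -L_0 - t and -L_0 + t, and its
   entries (0, 2) and (0, 1) are L_1 and -L_2. *)
exists (\col_i [:: - (Y 0 3 + Y 1 2) / 2; Y 0 2; - Y 0 1]`_i), ((Y 1 2 - Y 0 3) / 2).
by rewrite isoc_rows; apply/matrixP; apply: forall_ord4; apply: forall_ord4;
  rewrite !mxE /=; lra.
Qed.

End SymmetryGroup.

(** * From invariance under G to vanishing flows *)

Section SymmetryGroupAction.
Variable R : realType.
Local Notation K := (K_mx R).

(* The three positions and the three momenta as six vectors of R^4, in the order
   of the rows of [J6]. *)
Definition qp (i : 'I_(3 + 3)) (a : 'I_4) : 'I_phase_dim :=
  match fintype.split i with inl j => qvar j a | inr j => pvar j a end.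

Lemma qp_lshift j a : qp (lshift 3 j) a = qvar j a.
Proof. by rewrite /qp (unsplitK (inl j)). Qed.

Lemma qp_rshift j a : qp (rshift 3 j) a = pvar j a.
Proof. by rewrite /qp (unsplitK (inr j)). Qed.

Lemma qp_bij : bijective (fun p => qp p.1 p.2).
Proof.
apply: inj_card_bij; last by rewrite card_prod !card_ord.
move=> [i a] [j b] /=; case: (split_ordP i) => k ->; case: (split_ordP j) => l ->;
  rewrite ?qp_lshift ?qp_rshift => /eqP; rewrite ?qvar_eq ?pvar_eq ?qvar_pvar ?pvar_qvar //;
  by case/andP => /eqP -> /eqP ->.
Qed.

Lemma qp_surj k : exists i a, k = qp i a.
Proof. by have [g _ gK] := qp_bij; exists (g k).1, (g k).2; rewrite gK. Qed.

Lemma phase_coord_qp (T : Type) (Q P : 'I_3 -> 'cV[T]_4) i a :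
  phase_coord Q P (qp i a) = (match fintype.split i with inl j => Q j | inr j => P j end) a 0.
Proof.
by rewrite /qp; case: fintype.split => j; rewrite ?phase_coord_qvar ?phase_coord_pvar.
Qed.

Lemma pairing_invariant (C : 'M[R]_4) i j : (forall S, G S -> S^T *m C *m S = C) ->
  @invariants R (pairing qp C i j).
Proof.
move=> SC S /SC SCS Q P.
have E (Q' P' : 'I_3 -> 'cV[R]_4) : (pairing qp C i j).@[phase_coord Q' P']
  = ((match fintype.split i with inl k => Q' k | inr k => P' k end)^T *m C
     *m (match fintype.split j with inl k => Q' k | inr k => P' k end)) 0 0.
  rewrite mxE /pairing raddf_sum /=; under eq_bigr => a _ do rewrite raddf_sum /=.
  rewrite exchange_big; apply: eq_bigr => b _ /=.
  rewrite mxE mulr_suml; apply: eq_bigr => a _.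
  by rewrite mevalZ mevalM !mevalXU !phase_coord_qp mxE; ring.
rewrite !E.
have F k : (match fintype.split k with inl k => S *m Q k | inr k => S *m P k end)
  = S *m (match fintype.split k with inl k => Q k | inr k => P k end) by case: fintype.split.
by rewrite !F trmx_mul !mulmxA -(mulmxA _ S^T) -(mulmxA _ _ S) SCS.
Qed.

(** An invariant is constant along the curve (cos t + sin t J) v, whose velocity at t = 0 is J v;
    the chain rule turns this into the vanishing of the flow at each point v. *)
Lemma invariants_rotation_flow (f : {mpoly R[phase_dim]}) (J : 'M[R]_4) :
  invariants f -> (forall t, G ((cos t)%:A + sin t *: J)) -> linear_flow qp J f = 0.
Proof.
move=> If GJ; apply: meval_eq0 => v.
pose Q (i : 'I_3) : 'cV[R]_4 := \col_a v (qvar i a).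
pose P (i : 'I_3) : 'cV[R]_4 := \col_a v (pvar i a).
have vE : v =1 phase_coord Q P.
  move=> k; have [i [a ->]] := qp_surj k; rewrite phase_coord_qp /qp.
  by case: fintype.split => j; rewrite mxE.
pose c k t : R := phase_coord (fun i => ((cos t)%:A + sin t *: J) *m Q i)
                          (fun i => ((cos t)%:A + sin t *: J) *m P i) k.
pose c' k : R := phase_coord (fun i => J *m Q i) (fun i => J *m P i) k.
have cE k t : c k t = cos t * v k + sin t * c' k.
  rewrite vE /c /c'; have [i [a ->]] := qp_surj k; rewrite !phase_coord_qp.
  by case: fintype.split => j; rewrite mulmxDl -!scalemxAl mul1mx !mxE.
have dc k : is_derive (0 : R) 1 (c k) (c' k).
  rewrite (_ : c k = fun t => cos t * v k + sin t * c' k); last first.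
    by apply/funext => t; apply: cE.
  apply: is_derive_eq; rewrite /GRing.scale /= cos0 sin0.
  by rewrite oppr0 !mulr0 !add0r mulr1.
have := is_derive_meval f dc.
rewrite (_ : (fun s => _) = cst f.@[v]); last first.
  by apply/funext => t; rewrite (meval_eq _ vE); apply: If.
move=> [_]; rewrite derive_cst => E.
have c0 : (fun k => c k 0) =1 v by move=> k; rewrite cE cos0 sin0 mul0r addr0 mul1r.
rewrite /linear_flow raddf_sum /= [RHS]E {E}.
rewrite [RHS](reindex _ (onW_bij _ qp_bij)).
rewrite -(pair_bigA _ (fun i a => c' (qp i a) * (f^`M(qp i a)).@[fun k => c k 0])) /=.
rewrite exchange_big /=; apply: eq_bigr => a _.
transitivity (\sum_i \sum_b J a b * (v (qp i b) * (f^`M(qp i a)).@[v])).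
  rewrite raddf_sum exchange_big /=; apply: eq_bigr => b _.
  rewrite mevalZ raddf_sum mulr_sumr; apply: eq_bigr => i _ /=.
  by rewrite mevalM mevalXU.
apply: eq_bigr => i _; rewrite (meval_eq _ c0) /c' phase_coord_qp.
rewrite (_ : (match fintype.split i with inl _ => _ | inr _ => _ end)
    = J *m \col_b v (qp i b)).
  by rewrite mxE mulr_suml; apply: eq_bigr => b _; rewrite mxE mulrA.
rewrite /qp; case: fintype.split => j; congr (_ *m _); apply/colP => b; rewrite !mxE //.
Qed.

Lemma invariants_linear_flow (f : {mpoly R[phase_dim]}) (Y : 'M[R]_4) :
  invariants f -> Y^T = - Y -> Y *m K = K *m Y -> linear_flow qp Y f = 0.
Proof.
move=> If Yt YK; have [L [t ->]] := antisym_comm_isoc Yt YK.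
have [c [u [-> uu]]] := isoc_polar L.
rewrite isocZ linear_flowD !linear_flowZl !invariants_rotation_flow //.
- by rewrite !scaler0 addr0.
- exact: rotation_K_in_G.
- by move=> s; apply: rotation_in_G.
Qed.

End SymmetryGroupAction.

(** * Quadratic Hamiltonians and u(3,3) *)

(** The product (A + iB) J (A' + iB') in real form, with [K] playing the role of i: the two traces
    on the right carry its real and imaginary parts. *)
Lemma mxtrace_hermitian_product (S : comNzRingType) (k m : nat)
    (X : 'M[S]_(k, m)) (K : 'M[S]_m) (J A B A' B' : 'M[S]_k) : K *m K = - 1%:M ->
  \tr ((X^T *m A - K *m X^T *m B) *m J *m (A' *m X - B' *m X *m K))
  = \tr (X^T *m (A *m J *m A' - B *m J *m B') *m X)
    - \tr (K *m X^T *m (A *m J *m B' + B *m J *m A') *m X).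
Proof.
move=> KK; have trB (M N : 'M[S]_m) : \tr (M - N) = \tr M - \tr N := raddfB _ M N.
have -> : (X^T *m A - K *m X^T *m B) *m J *m (A' *m X - B' *m X *m K)
   = (X^T *m (A *m J *m A') *m X - K *m X^T *m (B *m J *m A') *m X)
     - (X^T *m (A *m J *m B') *m X *m K - K *m (X^T *m (B *m J *m B') *m X *m K)).
  by rewrite mulmxBr !mulmxBl !mulmxA.
rewrite !trB [\tr (K *m (_ *m K))]mxtrace_mulC -[_ *m K *m K]mulmxA KK mulmxN mulmx1.
rewrite [\tr (_ *m K)]mxtrace_mulC !mulmxA.
rewrite mulmxBr mulmxBl mulmxDr mulmxDl trB mxtraceD !mulmxA.
by rewrite raddfN /=; ring.
Qed.

Section QuadraticForms.
Variables (R : realFieldType) (n m k : nat).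
Variable (x : 'I_k -> 'I_m -> 'I_n).
Hypothesis x_bij : bijective (fun p => x p.1 p.2).
Implicit Types (f g : {mpoly R[n]}) (C : 'M[R]_m) (al be : 'M[R]_k).

Local Notation pairing := (@pairing R n m 'I_k x).

Lemma pairing_tr C i j : pairing C i j = pairing C^T j i.
Proof.
rewrite /pairing exchange_big; apply: eq_bigr => b _; apply: eq_bigr => a _ /=.
by rewrite mxE mulrC.
Qed.

Lemma mderiv_pairing C i j s c :
  (pairing C i j)^`M(x s c)
  = (i == s)%:R *: (\sum_b C c b *: 'X_(x j b))
    + (j == s)%:R *: (\sum_a C a c *: 'X_(x i a)).
Proof.
have E D u v : \sum_a \sum_b D a b *: (('X_(x u a))^`M(x s c) * 'X_(x v b))
    = (u == s)%:R *: (\sum_b D c b *: 'X_(x v b)) :> {mpoly R[n]}.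
  rewrite (bigD1 c) //= [X in _ + X]big1 ?addr0 => [|a /negPf ac].
    rewrite scaler_sumr; apply: eq_bigr => b _.
    by rewrite mderivXU x_eq // eqxx andbT -scaler_nat -scalerAl mul1r scalerA mulrC -scalerA.
  by apply: big1 => b _; rewrite mderivXU x_eq // ac andbF mul0r scaler0.
rewrite {1}/pairing raddf_sum /=.
under eq_bigr => a _ do rewrite raddf_sum /=.
under eq_bigr => a _ do under eq_bigr => b _ do rewrite mderivZ mderivM scalerDr.
under eq_bigr => a _ do rewrite big_split /=.
rewrite big_split /= E; congr (_ + _).
rewrite exchange_big /=.
under eq_bigr => b _ do under eq_bigr => a _ do rewrite mulrC.
by rewrite (E (fun b a => C a b)).
Qed.

Lemma mderiv2_pairing C i j s c t d :
  (pairing C i j)^`M(x s c)^`M(x t d)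
  = (((i == s) && (j == t))%:R * C c d + ((j == s) && (i == t))%:R * C d c)%:MP.
Proof.
have E (D : 'I_m -> R) u : (\sum_b D b *: 'X_(x u b))^`M(x t d) = ((u == t)%:R * D d)%:MP
    :> {mpoly R[n]}.
  rewrite raddf_sum (bigD1 d) //= big1 ?addr0 => [|b /negPf bd].
    by rewrite mderivZ mderivXU x_eq // eqxx andbT -scaler_nat scalerA -mul_mpolyC mulr1 mulrC.
  by rewrite mderivZ mderivXU x_eq // bd andbF scaler0.
rewrite mderiv_pairing mderivD !mderivZ E (E (fun a => C a c)) -!mul_mpolyC -!mpolyCM.
by rewrite -mpolyCD !mulrA -!natrM !mulnb.
Qed.

Variable K : 'M[R]_m.
Hypotheses (Ktr : K^T = - K) (KK : K *m K = - 1%:M).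

(** Twice the Hamiltonian of the complex matrix al + i be, which is Hermitian when [al] is symmetric
    and [be] antisymmetric. *)
Definition quad al be : {mpoly R[n]} :=
  \sum_i \sum_j (al i j *: pairing 1%:M i j + be i j *: pairing K i j).

Definition var_mx : 'M[{mpoly R[n]}]_(k, m) := \matrix_(i, a) 'X_(x i a).

Definition grad_mx f : 'M[{mpoly R[n]}]_(k, m) := \matrix_(i, a) f^`M(x i a).

Local Notation cmx := (map_mx (@mpolyC n R)).

Lemma pairing_mx C i j : pairing C i j = (var_mx *m cmx C *m var_mx^T) i j.
Proof.
rewrite mxE /pairing exchange_big; apply: eq_bigr => b _ /=.
rewrite !mxE mulr_suml; apply: eq_bigr => a _.
by rewrite !mxE -mul_mpolyC mulrCA mulrA.
Qed.

Lemma quad_trace al be :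
  quad al be = \tr (var_mx^T *m cmx al *m var_mx)
               - \tr (cmx K *m var_mx^T *m cmx be *m var_mx).
Proof.
have E (M : 'M[R]_k) (A : 'M[{mpoly R[n]}]_k) :
    \tr (cmx M *m A) = \sum_i \sum_j M i j *: A j i.
  apply: eq_bigr => i _; rewrite mxE; apply: eq_bigr => j _.
  by rewrite mxE mul_mpolyC.
have -> : \tr (var_mx^T *m cmx al *m var_mx) = \sum_i \sum_j al i j *: pairing 1%:M i j.
  rewrite -mulmxA mxtrace_mulC -mulmxA E.
  apply: eq_bigr => i _; apply: eq_bigr => j _; congr (_ *: _).
  by rewrite pairing_tr trmx1 pairing_mx map_mx1 mulmx1.
have -> : \tr (cmx K *m var_mx^T *m cmx be *m var_mx)
    = - \sum_i \sum_j be i j *: pairing K i j.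
  rewrite -mulmxA mxtrace_mulC -mulmxA E -sumrN; apply: eq_bigr => i _.
  rewrite -sumrN; apply: eq_bigr => j _; rewrite -scalerN; congr (_ *: _).
  rewrite mulmxA -pairing_mx pairing_tr Ktr /pairing -sumrN; apply: eq_bigr => a _.
  by rewrite -sumrN; apply: eq_bigr => b _; rewrite mxE scaleNr.
rewrite opprK -big_split; apply: eq_bigr => i _; rewrite -big_split.
by apply: eq_bigr => j _.
Qed.

Lemma grad_mxD f g : grad_mx (f + g) = grad_mx f + grad_mx g.
Proof. by apply/matrixP => i a; rewrite !mxE mderivD. Qed.

Lemma grad_sum_pairing (M : 'M[R]_k) C :
  grad_mx (\sum_i \sum_j M i j *: pairing C i j)
  = cmx M *m var_mx *m cmx C^T + cmx M^T *m var_mx *m cmx C.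
Proof.
have E (N : 'M[R]_k) (D : 'M[R]_m) s c :
    \sum_j N s j *: (\sum_b D b c *: 'X_(x j b)) = (cmx N *m var_mx *m cmx D) s c.
  rewrite -mulmxA mxE; apply: eq_bigr => j _; rewrite mxE mul_mpolyC; congr (_ *: _).
  by rewrite mxE; apply: eq_bigr => b _; rewrite !mxE mulrC mul_mpolyC.
apply/matrixP => s c; rewrite [RHS]mxE -!E mxE raddf_sum /=.
under eq_bigr => i _ do rewrite raddf_sum /=.
under eq_bigr => i _ do under eq_bigr => j _ do
  rewrite mderivZ mderiv_pairing scalerDr.
under eq_bigr => i _ do rewrite big_split /=.
rewrite big_split /=; congr (_ + _).
  rewrite (bigD1 s) //= [X in _ + X]big1 ?addr0 => [|i /negPf is_]; last first.
    by apply: big1 => j _; rewrite is_ scale0r scaler0.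
  apply: eq_bigr => j _; rewrite eqxx scale1r; congr (_ *: _).
  by apply: eq_bigr => b _; rewrite mxE.
rewrite exchange_big (bigD1 s) //= [X in _ + X]big1 ?addr0 => [|j /negPf js]; last first.
  by apply: big1 => i _; rewrite js scale0r scaler0.
by apply: eq_bigr => i _; rewrite eqxx scale1r mxE.
Qed.

Lemma grad_quad al be : al^T = al -> be^T = - be ->
  grad_mx (quad al be)
  = (cmx al *m var_mx - cmx be *m var_mx *m cmx K) *+ 2.
Proof.
move=> alt bet.
have -> : quad al be = \sum_i \sum_j al i j *: pairing 1%:M i j
    + \sum_i \sum_j be i j *: pairing K i j.
  by rewrite -big_split; apply: eq_bigr => i _; rewrite -big_split.
rewrite grad_mxD !grad_sum_pairing alt bet Ktr trmx1 map_mx1 !mulmx1 !map_mxN.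
by rewrite !mulmxN !mulNmx -!mulr2n mulrnBl mulNrn.
Qed.

(** Each gradient of a quadratic form contributes a factor 2, hence 4; the remaining trace is
    [mxtrace_hermitian_product]. *)
Lemma trace_grad_quad (J al be al' be' : 'M[R]_k) :
  al^T = al -> be^T = - be -> al'^T = al' -> be'^T = - be' ->
  \tr ((grad_mx (quad al be))^T *m cmx J *m grad_mx (quad al' be'))
  = quad (al *m J *m al' - be *m J *m be') (al *m J *m be' + be *m J *m al') *+ 4.
Proof.
move=> alt bet alt' bet'; rewrite !grad_quad // quad_trace.
have cKK : cmx K *m cmx K = - 1%:M by rewrite -map_mxM KK map_mxN map_mx1.
rewrite map_mxB map_mxD !map_mxM -mxtrace_hermitian_product //.
have <- : (cmx al *m var_mx - cmx be *m var_mx *m cmx K)^T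
    = var_mx^T *m cmx al - cmx K *m var_mx^T *m cmx be.
  rewrite raddfB /= !trmx_mul !map_trmx alt bet Ktr !map_mxN.
  by rewrite mulNmx !mulmxN opprK mulmxA.
move: (cmx al *m var_mx - _) (cmx al' *m var_mx - _) => U V.
have -> : (U *+ 2)^T = U^T + U^T by apply/matrixP => a i; rewrite mulr2n !mxE.
by rewrite mulr2n !mulmxDl !mulmxDr !mxtraceD; ring.
Qed.

(** Since x_i . x_j is symmetric and x_i . K x_j antisymmetric in (i, j), a form depends only on the
    Hermitian part of al + i be. *)
Lemma quad_sym al be : quad al be *+ 2 = quad (al + al^T) (be - be^T).
Proof.
have -> : quad (al + al^T) (be - be^T) = quad al be + quad al^T (- be^T).
  rewrite -big_split; apply: eq_bigr => i _; rewrite -big_split; apply: eq_bigr => j _ /=.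
  by rewrite [(al + _) i j]mxE [(be + _) i j]mxE !scalerDl addrACA.
rewrite mulr2n; congr (_ + _); rewrite [LHS]exchange_big; apply: eq_bigr => i _.
apply: eq_bigr => j _; rewrite !mxE pairing_tr trmx1; congr (_ + _).
rewrite pairing_tr Ktr /pairing scaleNr -scalerN; congr (_ *: _).
rewrite -sumrN; apply: eq_bigr => a _; rewrite -sumrN.
by apply: eq_bigr => b _; rewrite mxE scaleNr.
Qed.

End QuadraticForms.

(** * Second derivatives of products and of quadratic forms *)

Section SecondDerivatives.
Variables (R : realFieldType) (n : nat).
Implicit Types (f g : {mpoly R[n]}).

(** With vanishing gradients the mixed terms of the product rule disappear. This makes the
    polynomials with zero gradient and one prescribed zero second derivative at 0 closed under
    products. *)
Lemma hess_at0M f g i j : (forall l, (f^`M(l)).@[fun=> 0] = 0) ->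
  (forall l, (g^`M(l)).@[fun=> 0] = 0) ->
  ((f * g)^`M(i)^`M(j)).@[fun=> 0]
  = (f^`M(i)^`M(j)).@[fun=> 0] * g.@[fun=> 0]
    + f.@[fun=> 0] * (g^`M(i)^`M(j)).@[fun=> 0].
Proof.
move=> f0 g0; rewrite mderivM mderivD !mderivM !mevalD !mevalM !f0 !g0.
by rewrite !mul0r addr0 add0r.
Qed.

Variables (m k : nat) (x : 'I_k -> 'I_m -> 'I_n).
Hypothesis x_bij : bijective (fun p => x p.1 p.2).
Variable K : 'M[R]_m.

Lemma sum_delta2 (M : 'M[R]_k) (i j : 'I_k) (a b : R) :
  \sum_s \sum_t M s t * (((s == i) && (t == j))%:R * a + ((t == i) && (s == j))%:R * b)
  = M i j * a + M j i * b.
Proof.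
have E u v c : \sum_s \sum_t M s t * (((s == u) && (t == v))%:R * c) = M u v * c.
  rewrite (bigD1 u) //= (bigD1 v) //= !eqxx mul1r !big1 ?addr0 //.
    by move=> s /negPf su; rewrite big1 // => t _; rewrite su mul0r mulr0.
  by move=> t /negPf tv; rewrite tv andbF mul0r mulr0.
under eq_bigr => s _ do under eq_bigr => t _ do rewrite mulrDr.
under eq_bigr => s _ do rewrite big_split /=.
rewrite big_split /= E; congr (_ + _); rewrite -E.
by apply: eq_bigr => s _; apply: eq_bigr => t _; rewrite andbC.
Qed.

Lemma hess_quad (al be : 'M[R]_k) i j c d v : al^T = al -> be^T = - be -> K^T = - K ->
  ((quad x K al be)^`M(x i c)^`M(x j d)).@[v]
  = (al i j * (c == d)%:R + be i j * K c d) *+ 2.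
Proof.
move=> /matrixP/(_ i j) alt /matrixP/(_ i j) bet /matrixP/(_ c d) Kt.
pose D (h : {mpoly R[n]}) := (h^`M(x i c)^`M(x j d)).@[v].
have DD : {morph D : g h / g + h} by move=> g h; rewrite /D !mderivD mevalD.
have D0 : D 0 = 0 by rewrite /D !mderiv0 meval0.
transitivity (\sum_s \sum_t al s t *
    (((s == i) && (t == j))%:R * (1%:M : 'M[R]_m) c d
     + ((t == i) && (s == j))%:R * (1%:M : 'M[R]_m) d c)
  + \sum_s \sum_t be s t *
    (((s == i) && (t == j))%:R * K c d + ((t == i) && (s == j))%:R * K d c)).
  rewrite -/(D _) /quad (big_morph D DD D0) -big_split; apply: eq_bigr => s _.
  rewrite (big_morph D DD D0) -big_split; apply: eq_bigr => t _.
  rewrite DD /D !mderivZ !mevalZ.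
  by rewrite !mderiv2_pairing // !mevalC.
move: alt bet Kt; rewrite !sum_delta2 !mxE => -> -> -> /=.
by rewrite (eq_sym d); ring.
Qed.

End SecondDerivatives.

(** * Hermitian matrices and the Poisson bracket *)

Section HermitianForms.
Variable R : realType.
Local Notation K := (K_mx R).
Local Notation P := {mpoly R[phase_dim]}.
Local Notation at0 f := (f.@[fun=> 0]).
Implicit Types (F : 'M[R[i]]_(3 + 3)) (f g : P).

Definition Re_mx F : 'M[R]_(3 + 3) := map_mx (@complex.Re R) F.
Definition Im_mx F : 'M[R]_(3 + 3) := map_mx (@complex.Im R) F.

Definition hermitian F := map_mx (@conjc R) F^T = F.

(** With the factor 1/2, [hess_mx] returns [F] itself and the bracket formula carries no scalar. *)
Definition hermitian_quad F : P := 2^-1 *: quad qp K (Re_mx F) (Im_mx F).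

(* The 4 x 4 blocks of the Hessian have the form [alpha I + beta K] when [f] is in
   the span; since [K] has entry 1 at (3, 0), their first column gives
   [alpha + i beta]. *)
Definition hess_mx f : 'M[R[i]]_(3 + 3) :=
  \matrix_(i, j) ((at0 (f^`M(qp i 0)^`M(qp j 0)))
                  +i* (at0 (f^`M(qp i 3)^`M(qp j 0))))%C.

Lemma Re_hermitian F : hermitian F -> (Re_mx F)^T = Re_mx F.
Proof.
move=> /matrixP FH; apply/matrixP => i j; rewrite !mxE -[in RHS]FH !mxE.
by case: (F j i).
Qed.

Lemma Im_hermitian F : hermitian F -> (Im_mx F)^T = - Im_mx F.
Proof.
move=> /matrixP FH; apply/matrixP => i j; rewrite !mxE -[in RHS]FH !mxE.
by case: (F j i) => a b /=; rewrite opprK.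
Qed.

Lemma hess_hermitian_quad F : hermitian F -> hess_mx (hermitian_quad F) = F.
Proof.
move=> FH; apply/matrixP => i j; rewrite mxE /hermitian_quad !mderivZ !mevalZ.
rewrite !hess_quad ?Re_hermitian ?Im_hermitian ?K_antisym //; try exact: qp_bij.
rewrite !mxE /= ?mulr1 ?mulr0 ?addr0 ?add0r.
have h (a : R) : 2^-1 * (a *+ 2) = a by rewrite -(mulr_natl a) mulKf ?pnatr_eq0.
by rewrite !h; case: (F i j).
Qed.

Lemma hess_mx_linear (a : R) f g :
  hess_mx (a *: f + g) = (a%:C)%C *: hess_mx f + hess_mx g.
Proof.
apply/matrixP => i j; rewrite !mxE !mderivD !mderivZ !mevalD !mevalZ.
by apply/eqP; rewrite eq_complex /= !mul0r subr0 addr0 !eqxx.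
Qed.

Lemma hermitian_quad_linear (a : R) F F' :
  hermitian_quad ((a%:C)%C *: F + F') = a *: hermitian_quad F + hermitian_quad F'.
Proof.
rewrite /hermitian_quad scalerA mulrC -scalerA -scalerDr; congr (_ *: _).
rewrite /quad scaler_sumr -big_split; apply: eq_bigr => i _.
rewrite scaler_sumr -big_split; apply: eq_bigr => j _ /=.
rewrite !mxE; case: (F i j) (F' i j) => [u v] [u' v'] /=.
by rewrite !mul0r subr0 addr0 scalerDr !scalerDl !scalerA addrACA.
Qed.

Lemma hermitian_linear (a : R) F F' :
  hermitian F -> hermitian F' -> hermitian ((a%:C)%C *: F + F').
Proof.
move=> /matrixP FH /matrixP FH'; apply/matrixP => i j.
rewrite !mxE -[in RHS]FH -[in RHS]FH' !mxE.
case: (F j i) (F' j i) => [u v] [u' v']; apply/eqP; rewrite eq_complex /=.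
by apply/andP; split; apply/eqP; ring.
Qed.

Definition J6r : 'M[R]_(3 + 3) := block_mx 0 1%:M (- 1%:M) 0.

Lemma poisson_trace f g :
  poisson f g = \tr ((grad_mx qp f)^T *m map_mx (@mpolyC _ R) J6r *m grad_mx qp g).
Proof.
have gradE h : grad_mx qp h
    = col_mx (\matrix_(i, a) h^`M(qvar i a)) (\matrix_(i, a) h^`M(pvar i a)).
  apply/matrixP => i a; rewrite [LHS]mxE; case: (split_ordP i) => j ->.
    by rewrite col_mxEu mxE qp_lshift.
  by rewrite col_mxEd mxE qp_rshift.
rewrite !gradE tr_col_mx map_block_mx !map_mx0 map_mxN map_mx1 mul_row_block.
rewrite !mulmx0 addr0 add0r mulmxN !mulmx1 mul_row_col mxtraceD addrC.
have E (U V : 'M[P]_(3, 4)) : \tr (U^T *m V) = \sum_i \sum_a U i a * V i a.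
  rewrite exchange_big; apply: eq_bigr => a _; rewrite mxE; apply: eq_bigr => i _.
  by rewrite mxE.
rewrite mulNmx raddfN /= !E /poisson -sumrB; apply: eq_bigr => i _.
by rewrite -sumrB; apply: eq_bigr => a _; rewrite !mxE.
Qed.

Lemma poissonZZ (a b : R) f g : poisson (a *: f) (b *: g) = (a * b) *: poisson f g.
Proof.
rewrite /poisson scaler_sumr; apply: eq_bigr => i _; rewrite scaler_sumr.
apply: eq_bigr => c _; rewrite !mderivZ scalerBr.
by rewrite -!scalerAl -!scalerAr !scalerA.
Qed.

Lemma Re_mxM F F' : Re_mx (F *m F') = Re_mx F *m Re_mx F' - Im_mx F *m Im_mx F'.
Proof.
apply/matrixP => i j; rewrite !mxE raddf_sum -sumrB; apply: eq_bigr => l _.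
by rewrite !mxE; case: (F i l) (F' l j) => [u v] [u' v'].
Qed.

Lemma Im_mxM F F' : Im_mx (F *m F') = Re_mx F *m Im_mx F' + Im_mx F *m Re_mx F'.
Proof.
apply/matrixP => i j; rewrite !mxE raddf_sum -big_split; apply: eq_bigr => l _ /=.
by rewrite !mxE; case: (F i l) (F' l j) => [u v] [u' v'] /=; rewrite [v * _]mulrC addrC; ring.
Qed.

Lemma Re_mxB F F' : Re_mx (F - F') = Re_mx F - Re_mx F'.
Proof. by apply/matrixP => i j; rewrite !mxE raddfB. Qed.

Lemma Im_mxB F F' : Im_mx (F - F') = Im_mx F - Im_mx F'.
Proof. by apply/matrixP => i j; rewrite !mxE raddfB. Qed.

Lemma J6_real : J6 R = map_mx (real_complex R) J6r.
Proof. by rewrite /J6 map_block_mx !map_mx0 map_mxN map_mx1. Qed.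

Lemma Re_J6 : Re_mx (J6 R) = J6r.
Proof. by rewrite J6_real; apply/matrixP => i j; rewrite !mxE. Qed.

Lemma Im_J6 : Im_mx (J6 R) = 0.
Proof. by rewrite J6_real; apply/matrixP => i j; rewrite !mxE. Qed.

Lemma J6r_tr : J6r^T = - J6r.
Proof.
by rewrite /J6r tr_block_mx !trmx0 linearN /= trmx1 opp_block_mx opprK !oppr0.
Qed.

(** The trace formula yields the form of F J F', which need not be Hermitian. Its adjoint is - F' J
    F, so passing to the Hermitian part by [quad_sym] produces the difference. *)
Lemma poisson_hermitian_quad F F' : hermitian F -> hermitian F' ->
  poisson (hermitian_quad F) (hermitian_quad F')
  = hermitian_quad (F *m J6 R *m F' - F' *m J6 R *m F).
Proof.
move=> FH FH'; rewrite poissonZZ poisson_trace trace_grad_quad;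
  rewrite ?Re_hermitian ?Im_hermitian ?K_antisym ?K_sqr //; try exact: qp_bij.
set ga := (X in quad _ _ X _); set de := (X in quad _ _ _ X).
have gaT : ga^T = - (Re_mx F' *m J6r *m Re_mx F - Im_mx F' *m J6r *m Im_mx F).
  rewrite /ga raddfB /= !trmx_mul J6r_tr !Re_hermitian // !Im_hermitian //.
  by rewrite !(mulmxN, mulNmx) !opprK opprB addrC !mulmxA.
have deT : de^T = Re_mx F' *m J6r *m Im_mx F + Im_mx F' *m J6r *m Re_mx F.
  rewrite /de raddfD /= !trmx_mul J6r_tr !Re_hermitian // !Im_hermitian //.
  by rewrite !(mulmxN, mulNmx) !opprK addrC !mulmxA.
have -> : hermitian_quad (F *m J6 R *m F' - F' *m J6 R *m F)
    = 2^-1 *: quad qp K (ga + ga^T) (de - de^T).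
  rewrite /hermitian_quad Re_mxB Im_mxB !(Re_mxM, Im_mxM) Re_J6 Im_J6.
  by rewrite !mulmx0 !add0r !subr0 gaT deT.
rewrite -quad_sym ?K_antisym //.
rewrite -(scaler_nat 4 (quad _ _ _ _)) -(scaler_nat 2 (quad _ _ _ _)) !scalerA.
congr (_ *: _).
by field.
Qed.

End HermitianForms.

Section LinSpan.
Variables (R : realType) (V : lmodType R) (n : nat) (B : 'I_n -> V).

Lemma lin_span_mem j : lin_span B (B j).
Proof.
exists (fun k => (k == j)%:R); rewrite (bigD1 j) //= eqxx scale1r big1 ?addr0 //.
by move=> k /negPf ->; rewrite scale0r.
Qed.

Lemma lin_span0 : lin_span B 0.
Proof. by exists (fun=> 0); rewrite big1 // => j _; rewrite scale0r. Qed.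

Lemma lin_spanP a f g : lin_span B f -> lin_span B g -> lin_span B (a *: f + g).
Proof.
move=> [c ->] [d ->]; exists (fun j => a * c j + d j).
rewrite scaler_sumr -big_split; apply: eq_bigr => j _ /=.
by rewrite scalerDl scalerA.
Qed.

Lemma lin_spanZ a f : lin_span B f -> lin_span B (a *: f).
Proof. by move=> Bf; rewrite -[_ *: _]addr0; apply: lin_spanP => //; exact: lin_span0. Qed.

Lemma lin_spanD f g : lin_span B f -> lin_span B g -> lin_span B (f + g).
Proof. by move=> Bf Bg; rewrite -[f]scale1r; apply: lin_spanP. Qed.

Lemma lin_span_sum (I : finType) (F : I -> V) :
  (forall i, lin_span B (F i)) -> lin_span B (\sum_i F i).
Proof.
move=> BF; elim/big_ind: _ => //; first exact: lin_span0.
by move=> f g; apply: lin_spanD.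
Qed.

End LinSpan.

Section GeneratedAlgebra.
Variables (R : realType) (n : nat).
Implicit Types (A B : set {mpoly R[n]}).

Lemma subalg_closed_set A :
  A 1 -> (forall c f g, A f -> A g -> A (c *: f + g)) ->
  (forall f g, A f -> A g -> A (f * g)) -> GRing.subalg_closed (mem A).
Proof.
move=> A1 AL AM; split; first by rewrite -topredE /= in_setE.
- by move=> c f g; rewrite !inE; apply: AL.
- by move=> f g; rewrite !inE; apply: AM.
Qed.

Lemma subalg_set_closed A : GRing.subalg_closed (mem A) ->
  [/\ A 1, forall c f g, A f -> A g -> A (c *: f + g)
    & forall f g, A f -> A g -> A (f * g)].
Proof.
move=> [A1 AL AM]; split; first by move: A1; rewrite inE.
- by move=> c f g Af Ag; have := AL c f g; rewrite !inE; apply.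
- by move=> f g Af Ag; have := AM f g; rewrite !inE; apply.
Qed.

End GeneratedAlgebra.

(** * The 36 forms: generation, minimality and the isomorphism *)

Section LiePoissonAlgebra.
Variable R : realType.
Local Notation K := (K_mx R).
Local Notation P := {mpoly R[phase_dim]}.
Local Notation at0 f := (f.@[fun=> 0]).

(* One form for each unordered pair and type, as x_i . x_j is symmetric and
   x_i . K x_j antisymmetric in (i, j). *)
Definition basis_form (p : 'I_(3 + 3) * 'I_(3 + 3)) : P :=
  if (p.1 <= p.2)%N then pairing qp 1%:M p.1 p.2 else pairing qp K p.1 p.2.

(** A second derivative that isolates [basis_form p], up to a nonzero factor, among the basis forms.
    The entries (0, 0) and (0, 3) tell 1 from [K]: each is nonzero for just one of the two
    matrices. *)
Definition dual_form (p : 'I_(3 + 3) * 'I_(3 + 3)) (f : P) : R :=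
  at0 (f^`M(qp p.1 0)^`M(qp p.2 (if (p.1 <= p.2)%N then 0 else 3))).

Lemma dual_formL p (a : R) f g : dual_form p (a *: f + g) = a * dual_form p f + dual_form p g.
Proof. by rewrite /dual_form !mderivD !mderivZ mevalD mevalZ. Qed.

Lemma dual_form_basis p q : dual_form p (basis_form q)
  = (if (q.1 <= q.2)%N then ((p.1 <= p.2)%N)%:R * ((q == p)%:R + (q == (p.2, p.1))%:R)
     else ((p.2 < p.1)%N)%:R * ((q == (p.2, p.1))%:R - (q == p)%:R)).
Proof.
case: p q => i j [k l]; rewrite /dual_form /basis_form !xpair_eqE /= [(k == j) && _]andbC.
case: (leqP k l) => kl; case: (leqP i j) => ij; rewrite mderiv2_pairing ?mevalC ?mxE /=;
  try exact: qp_bij; ring.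
Qed.

Lemma dual_form_neq p q : p != q -> dual_form p (basis_form q) = 0.
Proof.
rewrite dual_form_basis eq_sym => /negPf qp; rewrite qp add0r subr0.
case: p q qp => i j [k l] qp; rewrite /= xpair_eqE.
have [kj|] := eqVneq k j; have [li|] := eqVneq l i; rewrite ?mulr0 ?if_same //.
move: qp; rewrite kj li xpair_eqE; case: (ltngtP i j) => ij; rewrite ?mul0r //.
by rewrite (val_inj ij) !eqxx.
Qed.

Lemma dual_form_eq p : dual_form p (basis_form p) != 0.
Proof.
rewrite dual_form_basis eqxx; case: p => i j /=; rewrite xpair_eqE (eq_sym j) andbb.
have [ij|ij] := leqP i j; rewrite mul1r; last first.
  by rewrite -(inj_eq val_inj) gtn_eqF // sub0r oppr_eq0 oner_eq0.
by rewrite -natrD pnatr_eq0.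
Qed.

Lemma basis_form_homog p : basis_form p \is 2.-homog.
Proof. by rewrite /basis_form; case: ifP => _; apply: dhomog_pairing. Qed.

Lemma basis_form_invariant p : invariants (basis_form p).
Proof.
rewrite /basis_form; case: ifP => _; apply: pairing_invariant => S GS.
  by rewrite mulmx1 G_orth.
by rewrite -mulmxA -G_comm // mulmxA G_orth // mul1mx.
Qed.

Lemma basis_form_grad0 p l : at0 ((basis_form p)^`M(l)) = 0.
Proof.
have [s [c ->]] := qp_surj l.
have E (C : 'M[R]_4) i j : at0 ((pairing qp C i j)^`M(qp s c)) = 0.
  rewrite mderiv_pairing; last exact: qp_bij.
  rewrite mevalD !mevalZ !raddf_sum /= !big1 ?mulr0 ?addr0 // => b _;
  by rewrite mevalZ mevalXU mulr0.
by rewrite /basis_form; case: ifP => _; apply: E.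
Qed.

Lemma invariants_subalg : GRing.subalg_closed (mem (@invariants R)).
Proof.
apply: subalg_closed_set.
- by move=> S _ Q P; rewrite !meval1.
- by move=> c f g If Ig S GS Q P; rewrite !mevalD !mevalZ (If S) // (Ig S).
- by move=> f g If Ig S GS Q P; rewrite !mevalM (If S) // (Ig S).
Qed.

Variable e : 'I_36 -> 'I_(3 + 3) * 'I_(3 + 3).
Hypothesis e_bij : bijective e.

Let B (k : 'I_36) : P := basis_form (e k).

Lemma e_surj p : exists k, e k = p.
Proof. by have [g _ gK] := e_bij; exists (g p); rewrite gK. Qed.

Lemma pairing1_spec i j : exists k, pairing qp 1%:M i j = B k.
Proof.
have [ij|ji] := leqP i j.
  by have [k ek] := e_surj (i, j); exists k; rewrite /B ek /basis_form /= ij.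
have [k ek] := e_surj (j, i); exists k.
by rewrite /B ek /basis_form /= ltnW // pairing_tr trmx1.
Qed.

Lemma pairingN (C : 'M[R]_4) i j : pairing qp (- C) i j = - pairing qp C i j.
Proof.
rewrite /pairing -sumrN; apply: eq_bigr => a _; rewrite -sumrN.
by apply: eq_bigr => b _; rewrite mxE scaleNr.
Qed.

Lemma pairingK_spec i j : exists (c : R) k, pairing qp K i j = c *: B k.
Proof.
have HC u v : pairing qp K u v = - pairing qp K v u.
  by rewrite pairing_tr K_antisym pairingN.
have [[k ek] [l el]] := (e_surj (i, j), e_surj (j, i)).
have [ij|ji|ij] := ltngtP i j.
- exists (-1), l; rewrite /B el /basis_form /= leqNgt ij scaleN1r; exact: HC.
- by exists 1, k; rewrite /B ek /basis_form /= leqNgt ji scale1r.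
exists 0, k; rewrite scale0r; have ->: i = j by apply: val_inj.
have /eqP := HC j j.
by rewrite -addr_eq0 -mulr2n -scaler_nat scaler_eq0 pnatr_eq0 => /eqP.
Qed.

Lemma generated_basis : generated_algebra (range B) = @invariants R.
Proof.
rewrite eqEsubset; split.
  apply: smallest_sub; first exact: invariants_subalg.
  by move=> _ [k _ <-]; apply: basis_form_invariant.
(* Here [A] is an arbitrary subalgebra containing the forms, and serves as the predicate of
   [unitary_fft]. *)
move=> f If A [/subalg_set_closed [A1 AL AM] BA].
have A0 : A 0 by rewrite -(subrr 1) -scaleN1r addrC; apply: AL.
have AB k : A (B k) by apply: BA; exists k.
apply: (@unitary_fft R _ _ _ qp qp_bij K (K_antisym R) (K_sqr R) A f) => //.
- by move=> i j; have [k ->] := pairing1_spec i j.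
- by move=> i j; have [c [k ->]] := pairingK_spec i j; rewrite -[_ *: _]addr0; apply: AL.
- by move=> Y; apply: invariants_linear_flow.
Qed.

Lemma basis_form_lin_indep : lin_indep B.
Proof.
move=> c c0 j.
have := congr1 (dual_form (e j)) c0.
have D0 : dual_form (e j) 0 = 0 by rewrite /dual_form !mderiv0 meval0.
have DD : {morph dual_form (e j) : f g / f + g}.
  by move=> f g; rewrite -[f in LHS]scale1r dual_formL mul1r.
rewrite (big_morph _ DD D0) (bigD1 j) //= big1 => [|k kj].
  rewrite -[_ *: _]addr0 dual_formL !D0 !addr0 => /eqP.
  by rewrite mulf_eq0 (negPf (dual_form_eq _)) orbF => /eqP.
rewrite -[_ *: _]addr0 dual_formL D0 dual_form_neq ?mulr0 ?addr0 //.
by rewrite (bij_eq e_bij) eq_sym.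
Qed.

(** A form that is left out cannot be recovered from the others: its dual form vanishes on them and,
    by [hess_at0M], on everything they generate. *)
Lemma basis_form_minimal B' : B' `<=` range B ->
  generated_algebra B' = @invariants R -> B' = range B.
Proof.
move=> B'B genB'; rewrite eqEsubset; split=> // _ [j _ <-].
apply: contrapT => B'j.
(* A subalgebra which contains [B'] but not [B j]. *)
pose A : set P := [set f | (forall l, at0 (f^`M(l)) = 0) /\ dual_form (e j) f = 0].
have : generated_algebra B' `<=` A.
  apply: smallest_sub.
    apply: subalg_closed_set.
    - by split=> [l|]; rewrite /dual_form -mpolyC1 !mderivC ?mderiv0 meval0.
    - move=> c f g [f0 fj] [g0 gj]; split=> [l|].
        by rewrite mderivD mderivZ mevalD mevalZ f0 g0 mulr0 addr0.
      by rewrite dual_formL fj gj mulr0 addr0.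
    - move=> f g [f0 fj] [g0 gj]; split=> [l|].
        by rewrite mderivM mevalD !mevalM f0 g0 mul0r mulr0 addr0.
      rewrite /dual_form hess_at0M // -/(dual_form (e j) f) -/(dual_form (e j) g).
      by rewrite fj gj mul0r mulr0 addr0.
  move=> f B'f; have [k _ fk] := B'B f B'f; rewrite -fk; split=> [l|].
    exact: basis_form_grad0.
  apply: dual_form_neq; apply/eqP => /(bij_inj e_bij) jk.
  by apply: B'j; rewrite jk fk.
rewrite genB' => /(_ (B j) (basis_form_invariant _)) [_] /eqP.
exact/negP/dual_form_eq.
Qed.

Lemma hermitian_elem (u : R[i]) i j :
  hermitian (u *: delta_mx i j + conjc u *: delta_mx j i).
Proof.
apply/matrixP => s t; rewrite !mxE [(t == i) && _]andbC [(t == j) && _]andbC.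
by rewrite rmorphD !rmorphM !rmorph_nat /= conjcK addrC.
Qed.

(** The values u = 1 and u = i give the two kinds of basis forms, so each of them is the Hamiltonian
    of a Hermitian matrix. *)
Lemma hermitian_quad_elem (u : R[i]) i j :
  hermitian_quad (u *: delta_mx i j + conjc u *: delta_mx j i)
  = complex.Re u *: pairing qp 1%:M i j + complex.Im u *: pairing qp K i j.
Proof.
have E (g : 'I_(3 + 3) -> 'I_(3 + 3) -> P) k l :
    \sum_s \sum_t ((s == k) && (t == l))%:R *: g s t = g k l.
  rewrite (bigD1 k) //= (bigD1 l) //= !eqxx scale1r !big1 ?addr0 //.
    by move=> s /negPf sk; rewrite big1 // => t _; rewrite sk scale0r.
  by move=> t /negPf tl; rewrite tl andbF scale0r.
pose g (c : R) s t := complex.Re u *: pairing qp 1%:M s t + c *: pairing qp K s t.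
transitivity (2^-1 *: (g (complex.Im u) i j + g (- complex.Im u) j i)).
  rewrite /hermitian_quad -(E (g _) i j) -(E (g _) j i) -big_split; congr (_ *: _).
  apply: eq_bigr => s _; rewrite -big_split; apply: eq_bigr => t _ /=.
  rewrite /g !scalerDr !scalerA addrACA -!scalerDl !mxE; case: (u) => a b.
  by case: (_ && _); case: (_ && _); rewrite /= ?mulr1n ?mulr0n;
    congr (_ *: _ + _ *: _); rewrite ?/GRing.scale /=; ring.
rewrite /g [pairing qp K j i]pairing_tr K_antisym pairingN scaleNr scalerN opprK.
rewrite [pairing qp 1%:M j i]pairing_tr trmx1 -mulr2n -(scaler_nat 2 (_ + _)) scalerA.
by rewrite mulVf ?scale1r // pnatr_eq0.
Qed.

Lemma lin_span_hermitian f :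
  lin_span B f <-> exists2 F, hermitian F & f = hermitian_quad F.
Proof.
split=> [|[F FH ->]].
  have herm0 : hermitian (0 : 'M[R[i]]_(3 + 3)).
    by apply/matrixP => i j; rewrite !mxE /= oppr0.
  have q0 : hermitian_quad (0 : 'M[R[i]]_(3 + 3)) = 0.
    have := hermitian_quad_linear (-1) (0 : 'M[R[i]]_(3 + 3)) 0.
    by rewrite scaler0 addr0 scaleN1r addNr.
  move=> [c ->]; apply: (big_ind (fun f => exists2 F, hermitian F & f = hermitian_quad F)).
  - by exists 0.
  - move=> g h [F FH ->] [F' FH' ->]; exists ((1%:C)%C *: F + F').
      exact: hermitian_linear.
    by rewrite hermitian_quad_linear scale1r.
  move=> k _; suff [F FH BF] : exists2 F, hermitian F & B k = hermitian_quad F.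
    exists ((c k)%:C%C *: F + 0); first exact: hermitian_linear.
    by rewrite hermitian_quad_linear q0 addr0 BF.
  pose F u : 'M[R[i]]_(3 + 3) :=
    u *: delta_mx (e k).1 (e k).2 + conjc u *: delta_mx (e k).2 (e k).1.
  rewrite /B /basis_form; case: ifP => _.
    exists (F 1); first exact: hermitian_elem.
    by rewrite hermitian_quad_elem /= scale1r scale0r addr0.
  exists (F 'i%C); first exact: hermitian_elem.
  by rewrite hermitian_quad_elem /= scale1r scale0r add0r.
apply: lin_spanZ; apply: lin_span_sum => i; apply: lin_span_sum => j; apply: lin_spanD.
  by apply: lin_spanZ; have [k ->] := pairing1_spec i j; apply: lin_span_mem.
apply: lin_spanZ; have [c [k ->]] := pairingK_spec i j.
by apply: lin_spanZ; apply: lin_span_mem.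
Qed.

Lemma J6_sqr : J6 R *m J6 R = - 1%:M.
Proof.
rewrite /J6 mulmx_block !(mulmx0, mul0mx, mulmx1, mul1mx, addr0, add0r).
by rewrite [X in _ = - X]scalar_mx_block opp_block_mx !oppr0.
Qed.

Lemma J6_tr : (J6 R)^T = - J6 R.
Proof. by rewrite /J6 tr_block_mx !trmx0 linearN /= trmx1 opp_block_mx opprK !oppr0. Qed.

Lemma J6_conj : map_mx conjc (J6 R) = J6 R.
Proof. by rewrite /J6 map_block_mx !map_mx0 map_mxN map_mx1. Qed.

Lemma hermitian_bracket F F' : hermitian F -> hermitian F' ->
  hermitian (F *m J6 R *m F' - F' *m J6 R *m F).
Proof.
rewrite /hermitian => FH FH'.
have E (U V : 'M[R[i]]_(3 + 3)) : map_mx conjc U^T = U -> map_mx conjc V^T = V ->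
    map_mx conjc (U *m J6 R *m V)^T = - (V *m J6 R *m U).
  move=> UH VH; rewrite !trmx_mul !map_mxM UH VH J6_tr map_mxN J6_conj.
  by rewrite mulNmx mulmxN mulmxA.
by rewrite raddfB map_mxB /= !E // opprK addrC.
Qed.

(** Since J J = -1, the matrix H J F is -i F, which is anti-Hermitian exactly when [F] is
    Hermitian. *)
Lemma u33_hermitian F : @u33 R (J6 R *m F) <-> hermitian F.
Proof.
rewrite /u33 /hermitian /= -!scalemxAl mulmxA J6_sqr mulNmx mul1mx scalerN.
have -> : map_mx conjc (- ('i%C *: F))^T = 'i%C *: map_mx conjc F^T.
  apply/matrixP => i j; rewrite !mxE rmorphN rmorphM /= -mulNr; congr (_ * _).
  by apply/eqP; rewrite eq_complex /= opprK oppr0 !eqxx.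
split=> [/eqP|->]; last exact: subrr.
rewrite -scalerBr scaler_eq0 subr_eq0 eq_complex /= oner_eq0 andbF.
by move=> /eqP.
Qed.

Lemma lie_isomorphic_u33 : lie_isomorphic (@poisson R) (lin_span B) (@u33 R).
Proof.
(* The matrix of the Hamiltonian vector field of [f]. *)
exists (fun f => J6 R *m hess_mx f); split.
- split.
  + move=> _ /lin_span_hermitian [F FH ->]; rewrite /= hess_hermitian_quad //.
    exact/u33_hermitian.
  + move=> f g; rewrite !inE => /lin_span_hermitian [F FH ->] /lin_span_hermitian [F' FH' ->].
    rewrite !hess_hermitian_quad // => /(congr1 (mulmx (J6 R))).
    by rewrite !mulmxA J6_sqr !mulNmx !mul1mx => /oppr_inj ->.
  (* The inverse of J is -J. *)
  + move=> M uM; pose F := - (J6 R *m M).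
    have ME : M = J6 R *m F by rewrite mulmxN mulmxA J6_sqr mulNmx mul1mx opprK.
    have FH : hermitian F by apply/u33_hermitian; rewrite -ME.
    exists (hermitian_quad F); last by rewrite hess_hermitian_quad.
    by apply/lin_span_hermitian; exists F.
- by move=> a f g _ _; rewrite hess_mx_linear mulmxDr scalemxAr.
move=> _ _ /lin_span_hermitian [F FH ->] /lin_span_hermitian [F' FH' ->].
rewrite poisson_hermitian_quad // !hess_hermitian_quad //; last exact: hermitian_bracket.
by rewrite mulmxBr !mulmxA.
Qed.

End LiePoissonAlgebra.

Theorem theorem4p1 (R : realType) :
  exists B : 'I_36 -> {mpoly R[phase_dim]},
    (forall j, B j \is 2.-homog /\ invariants (B j)) /\
    lin_indep B /\
    hilbert_basis (@invariants R) (range B) /\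
    (forall f g, lin_span B f -> lin_span B g -> lin_span B (poisson f g)) /\
    lie_isomorphic (@poisson R) (lin_span B) (@u33 R).
Proof.
have [e e_bij] : exists e : 'I_36 -> 'I_(3 + 3) * 'I_(3 + 3), bijective e.
  have card36 : 36 = #|{: 'I_(3 + 3) * 'I_(3 + 3)}| by rewrite card_prod !card_ord.
  exists (fun k => enum_val (cast_ord card36 k)).
  apply: bij_comp; first exact: enum_val_bij.
  by exists (cast_ord (esym card36)); [exact: cast_ordK | exact: cast_ordKV].
exists (fun k => basis_form R (e k)); split.
  by move=> j; split; [exact: basis_form_homog | exact: basis_form_invariant].
split; first exact: basis_form_lin_indep.
split; [split|split].
- exact: finite_image.
- by move=> _ [j _ <-]; exists 2; exact: basis_form_homog.
- exact: generated_basis.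
- exact: basis_form_minimal.
- move=> _ _ /(lin_span_hermitian e_bij) [F FH ->] /(lin_span_hermitian e_bij) [F' FH' ->].
  apply/lin_span_hermitian => //; rewrite poisson_hermitian_quad //.
  by eexists; [exact: hermitian_bracket FH FH' | by []].
exact: lie_isomorphic_u33.
Qed.
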